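(* Let $H$ be a genus-2 handlebody, and let $Z$ be a finite formal linear combination, with coefficients in $\mathbb{C}[t,t^{-1}]$, of skein terms in $H$ without self-crossings, obtained by resolving all the self-crossings of a diagram of a skein in $H$. Then the strand sorting method, applied to $Z$, produces only basis elements of the Kauffman Bracket Skein Module of $H$: every skein term of the resulting linear combination is a collection of disjoint (parallel) copies of the fundamental curves $x$, $y$, $z$ and the unknot.
   Context: **Setting.** A skein in $H$ is a framed link in $H$, i.e. an embedding of disjoint annuli, considered up to ambient isotopy. $H$ is viewed as (the thickening of a disk) with two vertical holes, called strand 1 (left) and strand 2 (right) of a fixed base braid. Skeins are represented by diagrams, with blackboard framing, in a front projection in which the two strands appear as two parallel vertical lines with their ends on the bottom and top boundary of $H$. The skein crosses a strand either over it (in front of it) or under it (behind it). Only crossings of the skein with itself (self-crossings) are ever resolved; crossings of the skein with the strands are not resolved. Looking along the direction of the strands, $H$ is the product of a 2-punctured disk with an interval, the punctures corresponding to the two strands. **Skein module and fundamental curves.** The Kauffman Bracket Skein Module of $H$ is the $\mathbb{C}[t,t^{-1}]$-module generated by isotopy classes of framed links in $H$, modulo the relation which replaces a self-crossing by $t$ times one smoothing plus $t^{-1}$ times the other smoothing (the Kauffman bracket skein relation) and the relation which removes a trivial component (unknot) at the cost of the factor $-t^{2}-t^{-2}$. The curve $x$ is the simple closed curve encircling strand 1 only, $z$ the simple closed curve encircling strand 2 only, and $y$ the simple closed curve encircling both strands (each being a simple closed curve in the 2-punctured disk). The power $x^m$ denotes $m$ parallel copies of $x$, and similarly for $y,z$.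 The basis elements are the collections of parallel copies of $x$, $y$, $z$. **Indices.** For each strand $n\in\{1,2\}$, the places where a skein term crosses strand $n$ are indexed increasingly from bottom to top. For a skein term, let $P_n$ be the set of indices on strand $n$ at which the skein crosses over strand $n$, $N_n$ the set of indices at which it crosses under strand $n$, and $B_n=P_n\cup N_n$. Each of these sets is taken over all components of the skein term. Each component of a skein term is also listed as an array of its successive crossings, in the order in which they are met while traversing the component from a chosen base point. **Strand sorting method.** The skein terms of $Z$ are processed one at a time. Each term is processed first for $n=1$, then for $n=2$, and for each $n$ the following is repeated until $P_n=\emptyset$. 1. *Induction decision.* As long as $\min(B_n)=\min(P_n)$, delete this minimum from both $P_n$ and $B_n$; if this makes $P_n$ empty, stop. Otherwise let $c=\min(P_n)$ and let $a$ be the largest element of $N_n$ with $a<c$. Then $a$ is the index of an undercrossing of strand $n$ lying immediately below the overcrossing of strand $n$ with index $c$. 2. *Inducing crossings.* Switch the positions of the two crossings with indices $a$ and $c$ along strand $n$, so that the overcrossing moves to the lower index and the undercrossing to the higher index. If the two crossings lie in the same component and are consecutive entries of its array, this is done by a Reidemeister $R1$ move (a twist), which induces one self-crossing. Otherwise it is done by a Reidemeister $R2$ move between the two pieces of the skein, which induces two self-crossings. 3. *Resolving.* Resolve the one or two induced self-crossings by the Kauffman bracket skein relation, replacing the term by 2 or 4 new skein terms without self-crossings. Continue with the first of these (with its updated $P_n,N_n,B_n$). The other new terms are inserted into the list of terms of $Z$ directly after it and are processed later in the same way. The output is the linear combination of skein terms obtained when all the terms in the list have been processed. *)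

(* Defs.v *)
(* Mathematical Components; the complex numbers are R[i] for R : realType. *)
From HB Require Import structures.
From Stdlib Require Import Relations.
From mathcomp Require Import all_boot all_order all_algebra fraction.
From mathcomp Require Import reals complex.

Set Implicit Arguments.
Unset Strict Implicit.
Unset Printing Implicit Defensive.

Import Order.TTheory GRing.Theory Num.Theory.

(** * Diagrams in the front projection of the genus-2 handlebody

    A diagram is put in general position with respect to the height function
    and is recorded by the list of its elementary events, from bottom to top.
    A horizontal slice between two events is the list, from left to right, of
    the points where it meets the diagram: [None] is a point of the skein,
    [Some n] is the hole (strand) [n].  Framings are blackboard framings.  The
    strands have no maxima or minima and never cross each other, so that they
    are two vertical lines up to planar isotopy. *)

Definition strand := bool.
Definition strand1 : strand := false.  (* left *)
Definition strand2 : strand := true.   (* right *)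

Definition point := option strand.
Definition slice := seq point.

(** [Cup i] is a local minimum creating the skein points [i] and [i.+1];
    [Cap i] is a local maximum joining the skein points [i] and [i.+1];
    [Cross b i] exchanges the points [i] and [i.+1]: going up, the point that
    moves to the right passes in front iff [b]. *)
Inductive event := Cup of nat | Cap of nat | Cross of bool & nat.

Definition event_code (e : event) : nat + nat + bool * nat :=
  match e with
  | Cup i => inl (inl i) | Cap i => inl (inr i) | Cross b i => inr (b, i)
  end.
Definition event_decode (c : nat + nat + bool * nat) : event :=
  match c with
  | inl (inl i) => Cup i | inl (inr i) => Cap i | inr (b, i) => Cross b i
  end.
Lemma event_codeK : cancel event_code event_decode. Proof. by case. Qed.
HB.instance Definition _ := Equality.copy event (can_type event_codeK).

Definition diagram := seq event.

Definition act (e : event) (s : slice) : option slice :=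
  match e with
  | Cup i => if i <= size s then Some (take i s ++ [:: None; None] ++ drop i s)
             else None
  | Cap i => if take 2 (drop i s) == [:: None; None]
             then Some (take i s ++ drop i.+2 s) else None
  | Cross _ i =>
      if drop i s is x :: y :: r then
        if (x == None) || (y == None) then Some (take i s ++ [:: y, x & r])
        else None
      else None
  end.

Definition run (D : diagram) (s : slice) : option slice :=
  foldl (fun os e => obind (act e) os) (Some s) D.

Definition empty_slice : slice := [:: Some strand1; Some strand2].

Definition is_skein_diagram (D : diagram) : bool :=
  run D empty_slice == Some empty_slice.

(** [slice_at D k] is the slice just below the event number [k]; that number
    is called the height of the event. *)
Definition slice_at (D : diagram) (k : nat) : slice :=
  odflt [::] (run (take k D) empty_slice).
Definition event_at (D : diagram) (k : nat) : event := nth (Cup 0) D k.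

Definition self_crossing (s : slice) (e : event) : bool :=
  if e is Cross _ i then take 2 (drop i s) == [:: None; None] else false.

Definition crossingless (D : diagram) : bool :=
  all (fun k => ~~ self_crossing (slice_at D k) (event_at D k))
      (iota 0 (size D)).

(** Skein terms: diagrams of skeins without self-crossings. *)
Definition skein_term (D : diagram) : bool :=
  is_skein_diagram D && crossingless D.

(** [Some (n, o)] if the skein crosses strand [n] at height [k], over it iff
    [o]. *)
Definition strand_crossing (D : diagram) (k : nat) : option (strand * bool) :=
  if event_at D k is Cross b i then
    match drop i (slice_at D k) with
    | None :: Some n :: _ => Some (n, b)
    | Some n :: None :: _ => Some (n, ~~ b)
    | _ => None
    end
  else None.

(** * Isotopy of framed links in the handlebody

    Planar isotopy, the Reidemeister moves R2 and R3 and the framed version of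
    R1, for the skein together with the strands. *)

Definition pos (e : event) : nat :=
  match e with Cup i | Cap i | Cross _ i => i end.
Definition at_pos (e : event) (j : nat) : event :=
  match e with Cup _ => Cup j | Cap _ => Cap j | Cross b _ => Cross b j end.
Definition arity (e : event) : nat := if e is Cup _ then 0 else 2.
Definition coarity (e : event) : nat := if e is Cap _ then 0 else 2.

Inductive move : diagram -> diagram -> Prop :=
| move_far e f of pos e + coarity e <= pos f :
    move [:: e; f] [:: at_pos f (pos f - coarity e + arity e); e]
| move_snake_l i : move [:: Cup i; Cap i.+1] [::]
| move_snake_r i : move [:: Cup i.+1; Cap i] [::]
| move_cup_slide b i :
    move [:: Cup i; Cross b i.+1] [:: Cup i.+1; Cross (~~ b) i]
| move_cap_slide b i :
    move [:: Cross b i.+1; Cap i] [:: Cross (~~ b) i; Cap i.+1]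
  (* a kink may be replaced by one of the same writhe on the other side *)
| move_R1_framed b i :
    move [:: Cup i.+1; Cross b i; Cap i.+1] [:: Cup i; Cross b i.+1; Cap i]
| move_R2 b i : move [:: Cross b i; Cross (~~ b) i] [::]
  (* the hypothesis says that none of the three pairwise over/under relations
     closes up into a cycle *)
| move_R3 b1 b2 b3 i of (b1 = b3 -> b2 = b1) :
    move [:: Cross b1 i; Cross b2 i.+1; Cross b3 i]
         [:: Cross b3 i.+1; Cross b2 i; Cross b1 i.+1].

Definition local_move (D D' : diagram) : Prop :=
  [/\ is_skein_diagram D, is_skein_diagram D' &
      exists u v l r, [/\ move u v, D = l ++ u ++ r & D' = l ++ v ++ r]].

Definition isotopic : diagram -> diagram -> Prop :=
  clos_refl_sym_trans diagram local_move.

(** * The fundamental curves *)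

Definition curve_x : diagram :=
  [:: Cup 0; Cross true 1; Cross true 1; Cap 0].
Definition curve_y : diagram :=
  [:: Cup 0; Cross true 1; Cross true 2; Cross true 2; Cross true 1; Cap 0].
Definition curve_z : diagram :=
  [:: Cup 1; Cross true 2; Cross true 2; Cap 1].
Definition unknot : diagram := [:: Cup 0; Cap 0].

(** Parallel copies of horizontal curves lie above one another. *)
Definition parallel_copies (i j k u : nat) : diagram :=
  flatten (nseq i curve_x ++ nseq j curve_y ++ nseq k curve_z
           ++ nseq u unknot).

(** * Kauffman bracket resolution

    [smoothings s D] lists the ways of smoothing all the self-crossings of [D]
    (read from the slice [s]), each with the exponent of its coefficient
    t^(#A - #B).  The A-smoothing joins the two regions swept by the
    overcrossing piece when it is turned counterclockwise. *)
Fixpoint smoothings (s : slice) (D : diagram) : seq (int * diagram) :=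
  if D is e :: D' then
    let rest := smoothings (odflt s (act e s)) D' in
    let vertical := [::] in
    let horizontal := [:: Cap (pos e); Cup (pos e)] in
    if self_crossing s e then
      let: (A, B) := if e is Cross true _ then (vertical, horizontal)
                     else (horizontal, vertical) in
      [seq ((1 + p.1)%R, A ++ p.2) | p <- rest] ++
      [seq ((-1 + p.1)%R, B ++ p.2) | p <- rest]
    else [seq (p.1, e :: p.2) | p <- rest]
  else [:: (0%R, [::])].

(** C[t,t^-1] is taken inside its field of fractions C(t). *)
Definition ratfun (R : realType) := {fraction {poly R[i]}}.
Definition tvar (R : realType) : ratfun R := FracField.tofrac ('X)%R.
Definition laurent (R : realType) (f : ratfun R) : Prop :=
  exists (p : {poly R[i]}) (m : nat), f = (FracField.tofrac p / tvar R ^+ m)%R.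

(** Formal linear combinations are lists of terms with coefficients. *)
Definition lincomb (R : realType) := seq (ratfun R * diagram).

Definition coefficient (R : realType) (Z : lincomb R) (T : diagram) : ratfun R :=
  (\sum_(p <- Z | p.2 == T) p.1)%R.

Definition resolve (R : realType) (D : diagram) : lincomb R :=
  [seq ((tvar R ^ p.1)%R, p.2) | p <- smoothings empty_slice D].

(** * Arrays of components

    A dart [(k, i, up)] is the point number [i] of the slice number [k], with a
    direction of travel, upwards iff [up]. *)
Definition dart := (nat * nat * bool)%type.

(** Travelling upwards from position [i] into the event [e]: whether the event
    is traversed (rather than turned back by a cap), and the new position. *)
Definition rise (e : event) (i : nat) : bool * nat :=
  match e with
  | Cup j => (true, if i < j then i else i.+2)
  | Cap j => if i < j then (true, i)
             else if i == j then (false, j.+1)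
             else if i == j.+1 then (false, j)
             else (true, i - 2)
  | Cross _ j => (true, if i == j then j.+1 else if i == j.+1 then j else i)
  end.

Definition upside_down (e : event) : event :=
  match e with Cup j => Cap j | Cap j => Cup j | Cross b j => Cross b j end.

Definition next_event (d : dart) : nat :=
  let: (k, _, up) := d in if up then k else k.-1.

Definition next_dart (D : diagram) (d : dart) : dart :=
  let: (k, i, up) := d in
  let e := event_at D (next_event d) in
  let: (through, i') := rise (if up then e else upside_down e) i in
  if through then (if up then k.+1 else k.-1, i', up) else (k, i', ~~ up).

Definition skein_points (D : diagram) : seq (nat * nat) :=
  flatten [seq [seq (k, i) | i <- iota 0 (size (slice_at D k))
                           & nth (Some strand1) (slice_at D k) i == None]
          | k <- iota 0 (size D).+1].

(** [cs] lists the components of [D], each of them once, and traversed once from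
    a base point (its first dart). *)
Definition traversal (D : diagram) (cs : seq (seq dart)) : bool :=
  all (fun c => (c != [::]) && fcycle (next_dart D) c) cs
  && perm_eq [seq d.1 | d <- flatten cs] (skein_points D).

(** The strand crossing that is met when leaving the dart [d], if any, together
    with whether the strand is crossed from left to right. *)
Definition crossing_met (D : diagram) (d : dart) : option (nat * bool) :=
  let h := next_event d in
  let i := d.1.2 in
  match strand_crossing D h, event_at D h with
  | Some _, Cross _ j =>
      if (i == j) || (i == j.+1) then Some (h, i == j) else None
  | _, _ => None
  end.

Definition component_array (D : diagram) (c : seq dart) : seq (nat * bool) :=
  pmap (crossing_met D) c.

(** [Some right] if the crossings at heights [a] and [c] are consecutive entries
    of the array of a component; [right] tells whether the arc joining them
    lies to the right of the strand. *)
Definition consecutive (D : diagram) (cs : seq (seq dart)) (a c : nat)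
    : option bool :=
  let steps := flatten [seq zip ar (behead ar)
                       | ar <- [seq component_array D x | x <- cs]] in
  ohead [seq p.1.2 | p <- steps
                   & ((p.1.1, p.2.1) == (a, c)) || ((p.1.1, p.2.1) == (c, a))].

(** * The strand sorting method *)

(** The indices on strand [n] are the heights of the crossings.  The lists [P],
    [N] and [B] are increasing, so their heads are their minima. *)
Definition P (D : diagram) (n : strand) : seq nat :=
  [seq k <- iota 0 (size D) | strand_crossing D k == Some (n, true)].
Definition N (D : diagram) (n : strand) : seq nat :=
  [seq k <- iota 0 (size D) | strand_crossing D k == Some (n, false)].
Definition B (D : diagram) (n : strand) : seq nat := merge leq (P D n) (N D n).

Fixpoint delete_minima (Pn Bn : seq nat) : seq nat :=
  match Pn, Bn with
  | p :: Pn', b :: Bn' => if b == p then delete_minima Pn' Bn' else Pn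
  | _, _ => Pn
  end.

Definition induction_decision (D : diagram) (n : strand) : option (nat * nat) :=
  if delete_minima (P D n) (B D n) is c :: _ then
    Some (last 0 [seq a <- N D n | a < c], c)
  else None.

(** Switching the undercrossing [a] and the overcrossing [c] of strand [n].
    The overcrossing piece is pulled down along the strand: it now crosses over
    the strand just below height [a], and its two legs run upwards on the two
    sides of the strand up to height [c].  The undercrossing piece, which passes
    behind all this, meets in turn one leg, the strand, the other leg.

    This is the R2 move, with two self-crossings.  When an arc joins [a] and [c]
    on one side of the strand, the R1 move turns the bight formed by this arc
    over, and only the self-crossing on the other side of the strand is
    induced.  On the side of the arc, the end of the arc coming from [a] is
    then attached to the new overcrossing and the end coming from [c] to the
    new undercrossing; that is the diagram of the R2 move with the
    self-crossing on that side replaced by a cap and a cup if the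
    undercrossing piece meets it before the strand (going up), and by two
    vertical arcs if after.  No factor is recorded for the full twist by which
    the R1 move changes the blackboard framing. *)
Definition switch (D : diagram) (n : strand) (a c : nat) (arc : option bool)
    : diagram :=
  let strand_pos k := index (Some n) (slice_at D k) in
  let p := strand_pos a in
  let q := strand_pos c in
  let a_rightwards := pos (event_at D a) != p in
  let c_rightwards := pos (event_at D c) != q in
  let cross j := [:: Cross (~~ a_rightwards) j] in
  let before j :=
    if arc == Some (~~ a_rightwards) then [:: Cap j; Cup j] else cross j in
  let after j := if arc == Some a_rightwards then [::] else cross j in
  let under := if a_rightwards then before p.-1 ++ cross p ++ after p.+1
               else before p.+2 ++ cross p.+1 ++ after p in
  let make_room k :=
    let e := event_at D k in
    if pos e <= strand_pos k then e else at_pos e (pos e).+2 in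
  take a D ++ [:: Cup p; Cross true p.+1] ++ under
  ++ [seq make_room k | k <- iota a.+1 (c - a.+1)]
  ++ [:: Cap (if c_rightwards then q.-1 else q.+2)] ++ drop c.+1 D.

(** The terms still in the list are in [todo]; its first term is being processed
    for the strand [current], the others have not been processed yet. *)
Record sort_state (R : realType) := SortState {
  done : lincomb R;
  current : strand;
  todo : lincomb R
}.

Definition sort_start (R : realType) (Z : lincomb R) : sort_state R :=
  SortState [::] strand1 Z.

(** [arr] chooses the base points (and directions) of the arrays. *)
Definition sort_step (R : realType) (arr : diagram -> seq (seq dart))
    (st : sort_state R) : sort_state R :=
  if todo st is (r, T) :: rest then
    let n := current st in
    if induction_decision T n is Some (a, c) then
      let T' := switch T n a c (consecutive T (arr T) a c) in
      SortState (done st) n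
        ([seq ((r * p.1)%R, p.2) | p <- resolve R T'] ++ rest)
    else if n == strand1 then SortState (done st) strand2 (todo st)
    else SortState (rcons (done st) (r, T)) strand1 rest
  else st.

(* Main.v *)
Require Import Defs.
From mathcomp Require Import all_boot all_algebra reals.
From Stdlib Require Import Relations.
From mathcomp Require Import zify.

(** Whatever smoothings are chosen, switching two crossings of a strand pulls a
    finger of the overcrossing piece down along the strand, and the strand meets
    the same crossings as before, except that one undercrossing and the next
    overcrossing have been exchanged.  Hence the number of inversions drops, and
    the method stops with terms in which, on each strand, all overcrossings lie
    below all undercrossings.

    Pulling fingers once more, now by isotopies, such a term becomes a word [O]
    passing in front of the strands followed by a word [U] passing behind them.
    As [O] never passes behind a strand, it can be pulled to the left of both:
    it becomes a diagram of cups followed by a comb that carries the skein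
    points back to their places, and so does [U] after a half turn.  In the
    horizontal disk between [O] and [U] these are two systems of arcs; one
    inducts on the number of their endpoints.  An innermost arc whose endpoints
    are not separated by a puncture is pushed to the other side.  If there is
    none, both systems have an innermost arc around the same puncture or around
    both, and the two arcs form a ring that slides down to the bottom. *)

Set Implicit Arguments.
Unset Strict Implicit.
Unset Printing Implicit Defensive.

(** * Words of events *)

(** Switching is never shown to preserve the isotopy class, and it need not: its self-crossings are
    smoothed in any way, and its R1 form changes the framing. What is tracked is the sequence of
    crossings with the strands, which every smoothing alters in the same way; isotopies enter only
    once a term is sorted.

    [isotopic] speaks of closed diagrams, so isotopies are built as [eqv s], for words starting at
    an arbitrary slice [s]; these can be stacked, put side by side and half-turned.

    The ring exists by a count: a system all of whose innermost arcs surround the same puncture is a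
    rainbow, with half of the endpoints on the left of that puncture. Two systems confined to
    different punctures would give two such halves, although endpoints lie between the punctures.

    The obstacle is the ring around both strands. A ring around one strand slides along it past
    every event, but skein running between the strands blocks the larger ring. That ring occurs only
    where no skein point lies between the strands, and there the comb leads both strands behind the
    same skein points. *)

Inductive acts : event -> slice -> slice -> Prop :=
| acts_cup (l r : slice) : acts (Cup (size l)) (l ++ r) (l ++ [:: None, None & r])
| acts_cap (l r : slice) : acts (Cap (size l)) (l ++ [:: None, None & r]) (l ++ r)
| acts_cross b (l : slice) x y (r : slice) of (x == None) || (y == None) :
    acts (Cross b (size l)) (l ++ [:: x, y & r]) (l ++ [:: y, x & r]).

Lemma take2_drop (T : eqType) (i : nat) (s : seq T) (x y : T) :
  take 2 (drop i s) = [:: x; y] ->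
  exists l r, s = l ++ [:: x, y & r] /\ i = size l.
Proof.
move=> h; exists (take i s), (drop 2 (drop i s)).
rewrite -[_ :: _]/([:: x; y] ++ _) -h !cat_take_drop; split=> //.
rewrite size_takel // leqNgt; apply/negP => lt_s.
by move: h; rewrite drop_oversize // ltnW.
Qed.

Lemma drop_size_cat2 (T : Type) (l r : seq T) (x y : T) :
  drop (size l).+2 (l ++ [:: x, y & r]) = r.
Proof. by rewrite -!cat_rcons drop_size_cat // !size_rcons. Qed.

Lemma actP (e : event) (s t : slice) : act e s = Some t <-> acts e s t.
Proof.
split; last first.
  case=> [l r|l r|b l x y r h] /=.
  - by rewrite size_cat leq_addr take_size_cat // drop_size_cat.
  - rewrite drop_size_cat //= take_size_cat // take0 eqxx.
    by rewrite drop_size_cat2.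
  - by rewrite drop_size_cat // h take_size_cat.
case: e => [i|i|b i] /=.
- case: ifP => // le_i [<-].
  by rewrite -{1}(size_takel le_i) -{2}(cat_take_drop i s); apply: acts_cup.
- case: eqP => // /take2_drop[l [r [-> ->]]] [<-].
  rewrite take_size_cat // drop_size_cat2.
  exact: acts_cap.
- case E: (drop i s) => [|x [|y r]] //; case: ifP => // h [<-].
  have le_i : i <= size s.
    by rewrite leqNgt; apply/negP => lt_s; move: E; rewrite drop_oversize // ltnW.
  by rewrite -{1}(size_takel le_i) -{2}(cat_take_drop i s) E; apply: acts_cross.
Qed.

Lemma run_cons (e : event) (D : diagram) (s : slice) :
  run (e :: D) s = obind (run D) (act e s).
Proof.
rewrite /run /=; case: (act e s) => //=.
by elim: D => //=.
Qed.

Lemma run_cat (D1 D2 : diagram) (s : slice) :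
  run (D1 ++ D2) s = obind (run D2) (run D1 s).
Proof.
elim: D1 s => // e D1 IH s; rewrite cat_cons !run_cons.
by case: (act e s) => //= t; rewrite IH.
Qed.

Lemma run_catS (D1 D2 : diagram) (s t u : slice) :
  run D1 s = Some t -> run D2 t = Some u -> run (D1 ++ D2) s = Some u.
Proof. by rewrite run_cat => -> /=. Qed.

Lemma run_catP (D1 D2 : diagram) (s u : slice) :
  run (D1 ++ D2) s = Some u ->
  exists2 t, run D1 s = Some t & run D2 t = Some u.
Proof. by rewrite run_cat; case: (run D1 s) => //= t h; exists t. Qed.

Lemma run_consP (e : event) (D : diagram) (s u : slice) :
  run (e :: D) s = Some u ->
  exists2 t, act e s = Some t & run D t = Some u.
Proof. by rewrite run_cons; case: (act e s) => //= t h; exists t. Qed.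

Lemma run1 (e : event) (s : slice) : run [:: e] s = act e s.
Proof. by []. Qed.

Definition offset_event (k : nat) (e : event) : event := at_pos e (k + pos e).
Definition offset (k : nat) (D : diagram) : diagram := map (offset_event k) D.

Lemma offset_cat (k : nat) (D1 D2 : diagram) :
  offset k (D1 ++ D2) = offset k D1 ++ offset k D2.
Proof. exact: map_cat. Qed.

Lemma offset_event0 (e : event) : offset_event 0 e = e.
Proof. by case: e. Qed.

Lemma offset0 (D : diagram) : offset 0 D = D.
Proof. by rewrite /offset (eq_map offset_event0) map_id. Qed.

Lemma offset_eventD (j k : nat) (e : event) :
  offset_event j (offset_event k e) = offset_event (j + k) e.
Proof. by case: e => * /=; rewrite /offset_event /= addnA. Qed.

Lemma offsetD (j k : nat) (D : diagram) : offset j (offset k D) = offset (j + k) D.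
Proof. by rewrite /offset -map_comp; apply: eq_map => e; apply: offset_eventD. Qed.

Lemma act_frame (e : event) (l s t r : slice) :
  act e s = Some t ->
  act (offset_event (size l) e) (l ++ s ++ r) = Some (l ++ t ++ r).
Proof.
move=> /actP h; apply/actP; case: h => [l' r'|l' r'|b l' x y r' h] /=;
  rewrite /offset_event /= -size_cat -!catA !cat_cons ?[l ++ _ ++ _]catA.
- exact: acts_cup.
- exact: acts_cap.
- exact: acts_cross.
Qed.

Lemma act_framel (e : event) (l s t : slice) :
  act e s = Some t -> act (offset_event (size l) e) (l ++ s) = Some (l ++ t).
Proof. by move=> /(act_frame l [::]); rewrite !cats0. Qed.

Lemma act_framer (e : event) (s t r : slice) :
  act e s = Some t -> act e (s ++ r) = Some (t ++ r).
Proof. by move=> /(act_frame [::] r); rewrite offset_event0. Qed.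

Lemma run_frame (D : diagram) (l s t r : slice) :
  run D s = Some t -> run (offset (size l) D) (l ++ s ++ r) = Some (l ++ t ++ r).
Proof.
elim: D s => [|e D IH] s; first by case=> ->.
move=> /run_consP[u hu /IH h].
by rewrite run_cons (act_frame l r hu).
Qed.

Lemma run_framel (D : diagram) (l s t : slice) :
  run D s = Some t -> run (offset (size l) D) (l ++ s) = Some (l ++ t).
Proof. by move=> /(run_frame l [::]); rewrite !cats0. Qed.

Lemma run_framer (D : diagram) (s t r : slice) :
  run D s = Some t -> run D (s ++ r) = Some (t ++ r).
Proof. by move=> /(run_frame [::] r); rewrite offset0. Qed.

(** * Isotopy of words starting at a given slice *)

(** Moves are needed on pieces of diagrams, which start at [s] and may end at any slice. Both runs
    may fail: asking only that they agree makes the relation stable under appending an arbitrary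
    word. *)
Definition word_step (s : slice) (D D' : diagram) : Prop :=
  run D s = run D' s /\
  exists u v l r, [/\ move u v, D = l ++ u ++ r & D' = l ++ v ++ r].

Definition eqv (s : slice) : diagram -> diagram -> Prop :=
  clos_refl_sym_trans diagram (word_step s).

Lemma eqv_refl (s : slice) (D : diagram) : eqv s D D.
Proof. exact: rst_refl. Qed.
#[local] Hint Resolve eqv_refl : core.

Lemma eqv_sym (s : slice) (D D' : diagram) : eqv s D D' -> eqv s D' D.
Proof. exact: rst_sym. Qed.

Lemma eqv_trans (s : slice) (D2 D1 D3 : diagram) :
  eqv s D1 D2 -> eqv s D2 D3 -> eqv s D1 D3.
Proof. exact: rst_trans. Qed.

Lemma eqv_run (s : slice) (D D' : diagram) : eqv s D D' -> run D s = run D' s.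
Proof. by elim=> [? ? []|//|//|? ? ? _ -> _ ->]. Qed.

Lemma eqv_move (s : slice) (D D' : diagram) :
  move D D' -> run D s = run D' s -> eqv s D D'.
Proof.
move=> m h; apply: rst_step; split=> //.
by exists D, D', [::], [::]; rewrite !cats0.
Qed.

Lemma eqv_catl (s t : slice) (l u v : diagram) :
  run l s = Some t -> eqv t u v -> eqv s (l ++ u) (l ++ v).
Proof.
move=> hl; elim=> [D D' [h [u' [v' [l' [r' [m eD eD']]]]]]|//|D D' _|? D ? _ h1 _ h2].
- subst D D'; apply: rst_step; split; first by rewrite !(run_cat l) hl /= h.
  by exists u', v', (l ++ l'), r'; rewrite -!catA.
- exact: eqv_sym.
- exact: eqv_trans h1 h2.
Qed.

Lemma eqv_catr (s : slice) (u v r : diagram) :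
  eqv s u v -> eqv s (u ++ r) (v ++ r).
Proof.
elim=> [D D' [h [u' [v' [l' [r' [m eD eD']]]]]]|//|D D' _|? D ? _ h1 _ h2].
- subst D D'; apply: rst_step; split; first by rewrite ![run (_ ++ r) _]run_cat h.
  by exists u', v', l', (r' ++ r); rewrite -!catA.
- exact: eqv_sym.
- exact: eqv_trans h1 h2.
Qed.

Lemma eqv_cat (s t : slice) (u v u' v' : diagram) :
  run u s = Some t -> eqv s u v -> eqv t u' v' -> eqv s (u ++ u') (v ++ v').
Proof.
move=> hu h h'; apply: (eqv_trans (eqv_catr u' h)).
by apply: eqv_catl h'; rewrite -(eqv_run h).
Qed.

Lemma move_offset (k : nat) (u v : diagram) :
  move u v -> move (offset k u) (offset k v).
Proof.
case=> [e f h|i|i|b i|b i|b i|b i|b1 b2 b3 i h]; rewrite /= /offset_event /= ?addnS.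
- have -> : at_pos (at_pos f (pos f - coarity e + arity e))
              (k + pos (at_pos f (pos f - coarity e + arity e))) =
            at_pos (at_pos f (k + pos f))
              (pos (at_pos f (k + pos f)) - coarity (at_pos e (k + pos e))
               + arity (at_pos e (k + pos e))).
    by case: f h => [j|j|c j]; case: e => [i|i|b i] /= h; congr (_ _); lia.
  by apply: move_far; case: f h => [j|j|c j]; case: e => [i|i|b i] /=; lia.
- exact: move_snake_l.
- exact: move_snake_r.
- exact: move_cup_slide.
- exact: move_cap_slide.
- exact: move_R1_framed.
- exact: move_R2.
- exact: move_R3.
Qed.

Lemma eqv_frame (D D' : diagram) (l s t r : slice) :
  run D s = Some t -> eqv s D D' ->
  eqv (l ++ s ++ r) (offset (size l) D) (offset (size l) D').
Proof.
move=> hD h; elim: h hD => [D1 D2 [h [u [v [a [b [m e1 e2]]]]]]|//|D1 D2|? D1 ?].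
- subst D1 D2; move=> hD; apply: rst_step; split.
    by rewrite (run_frame l r hD) (run_frame l r (etrans (esym h) hD)).
  exists (offset (size l) u), (offset (size l) v), (offset (size l) a), (offset (size l) b).
  by rewrite -!offset_cat; split=> //; apply: move_offset.
- by move=> h IH hD; apply/eqv_sym/IH; rewrite (eqv_run h).
- move=> h IH _ IH' hD; apply: eqv_trans (IH hD) (IH' _).
  by rewrite -(eqv_run h).
Qed.

Lemma eqv_framel (D D' : diagram) (l s t : slice) :
  run D s = Some t -> eqv s D D' ->
  eqv (l ++ s) (offset (size l) D) (offset (size l) D').
Proof. by move=> hD /(eqv_frame l [::] hD); rewrite cats0. Qed.

Lemma eqv_framer (D D' : diagram) (s t r : slice) :
  run D s = Some t -> eqv s D D' -> eqv (s ++ r) D D'.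
Proof. by move=> hD /(eqv_frame [::] r hD); rewrite !offset0. Qed.

Lemma isotopic_eqv (D D' : diagram) :
  is_skein_diagram D -> eqv empty_slice D D' -> isotopic D D'.
Proof.
move=> hD h; elim: h hD => [D1 D2 [h w]|D1|D1 D2|D1 D2 D3].
- move=> hD; apply: rst_step; split=> //.
  by rewrite /is_skein_diagram -h.
- by move=> _; apply: rst_refl.
- move=> h IH hD; apply/rst_sym/IH.
  by rewrite /is_skein_diagram (eqv_run h).
- move=> h IH _ IH' hD; apply: rst_trans (IH hD) (IH' _).
  by rewrite /is_skein_diagram -(eqv_run h).
Qed.

(** The rotation around the left-right axis of the projection.  It exchanges
    bottom and top and also front and back, so that it keeps the flag of a
    [Cross] but turns overcrossings of the strands into undercrossings. *)
Definition half_turn (D : diagram) : diagram := rev (map upside_down D).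

Lemma half_turn_cat (D1 D2 : diagram) : half_turn (D1 ++ D2) = half_turn D2 ++ half_turn D1.
Proof. by rewrite /half_turn map_cat rev_cat. Qed.

Lemma upside_downK : involutive upside_down.
Proof. by case. Qed.

Lemma half_turnK : involutive half_turn.
Proof.
by move=> D; rewrite /half_turn map_rev revK -map_comp (eq_map upside_downK) map_id.
Qed.

Lemma act_upside_down (e : event) (s t : slice) :
  act e s = Some t -> act (upside_down e) t = Some s.
Proof.
move=> /actP h; apply/actP; case: h => [l r|l r|b l x y r h].
- exact: acts_cap.
- exact: acts_cup.
- by apply: acts_cross; rewrite orbC.
Qed.

Lemma run_half_turn (D : diagram) (s t : slice) :
  run D s = Some t -> run (half_turn D) t = Some s.
Proof.
elim: D s => [|e D IH] s; first by case=> ->.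
move=> /run_consP[u hu /IH h].
by rewrite -cat1s half_turn_cat; apply: run_catS h _; rewrite run1 (act_upside_down hu).
Qed.

(** Exchanging bottom and top reverses the direction of [move_far], where the left event goes from
    below to above; the other moves become moves in the same direction. *)
Lemma move_half_turn (u v : diagram) :
  move u v -> move (half_turn u) (half_turn v) \/ move (half_turn v) (half_turn u).
Proof.
case=> [e f h|i|i|b i|b i|b i|b i|b1 b2 b3 i h]; rewrite /half_turn /rev /=.
- right.
  have -> : upside_down f =
     at_pos (upside_down (at_pos f (pos f - coarity e + arity e)))
       (pos (upside_down (at_pos f (pos f - coarity e + arity e)))
        - coarity (upside_down e) + arity (upside_down e)).
    by case: f h => [j|j|c j]; case: e => [i|i|b i] /= h; congr (_ _); lia.
  by apply: move_far; case: f h => [j|j|c j]; case: e => [i|i|b i] /=; lia.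
- by left; apply: move_snake_r.
- by left; apply: move_snake_l.
- by left; apply: move_cap_slide.
- by left; apply: move_cup_slide.
- by left; apply: move_R1_framed.
- by left; rewrite -{2}[b]negbK; apply: move_R2.
- by left; apply: move_R3 => eq_b; rewrite eq_b h.
Qed.

Lemma eqv_half_turn (s t : slice) (D D' : diagram) :
  run D s = Some t -> eqv s D D' -> eqv t (half_turn D) (half_turn D').
Proof.
move=> hD h; elim: h hD => [D1 D2 [h [u [v [a [b [m e1 e2]]]]]]|//|D1 D2|? D1 ?].
- subst D1 D2; move=> hD.
  have eq_run : run (half_turn (a ++ u ++ b)) t = run (half_turn (a ++ v ++ b)) t.
    by rewrite (run_half_turn hD) (run_half_turn (etrans (esym h) hD)).
  move: eq_run; rewrite !half_turn_cat -!catA => eq_run.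
  by case: (move_half_turn m) => m'; [|apply: eqv_sym]; apply: rst_step; split=> //;
    [exists (half_turn u), (half_turn v)|exists (half_turn v), (half_turn u)];
    exists (half_turn b), (half_turn a).
- by move=> h IH hD; apply/eqv_sym/IH; rewrite (eqv_run h).
- move=> h IH _ IH' hD; apply: eqv_trans (IH hD) (IH' _).
  by rewrite -(eqv_run h).
Qed.

Lemma far_events (e f : event) (s1 t1 s2 t2 : slice) :
  act e s1 = Some t1 -> act f s2 = Some t2 ->
  eqv (s1 ++ s2) [:: e; offset_event (size t1) f] [:: offset_event (size s1) f; e].
Proof.
move=> he hf.
have h1 := act_framer s2 he; have h1' := act_framer t2 he.
have h2 := act_framel t1 hf; have h2' := act_framel s1 hf.
have sz : size t1 + arity e = size s1 + coarity e /\ pos e + coarity e <= size t1.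
  case: (proj1 (actP _ _ _) he) => [l r|l r|b l x y r _] /=; rewrite !size_cat /=; lia.
apply: eqv_move; last by rewrite !run_cons h1 h2' /= !run1 h2 h1'.
have -> : offset_event (size s1) f =
    at_pos (offset_event (size t1) f)
      (pos (offset_event (size t1) f) - coarity e + arity e).
  case: (f) sz => [i|i|b i] /= [h hp]; congr (_ _) => /=; lia.
by apply: move_far; case: (f) sz => [i|i|b i] /=; lia.
Qed.

(** Words acting side by side do not meet, so either may come first; [D2] is shifted by what it has
    on its left at that time, [t1] after [D1] and [s1] before it. *)
Lemma eqv_interchange (D1 D2 : diagram) (s1 t1 s2 t2 : slice) :
  run D1 s1 = Some t1 -> run D2 s2 = Some t2 ->
  eqv (s1 ++ s2) (D1 ++ offset (size t1) D2) (offset (size s1) D2 ++ D1).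
Proof.
elim: D1 s1 => [|e D1 IH] s1; first by case=> <-; rewrite cats0.
move=> /run_consP[u hu hD1] hD2.
have he : run [:: e] (s1 ++ s2) = Some (u ++ s2) by apply: run_framer.
apply: (@eqv_trans _ ([:: e] ++ (offset (size u) D2 ++ D1))).
  by apply: eqv_catl he _; apply: IH.
rewrite catA -[offset _ _ ++ e :: D1]/(offset (size s1) D2 ++ [:: e] ++ D1) catA.
apply: eqv_catr => {IH hD1 he}.
elim: D2 s2 hD2 => [|f D2 IH] s2; first by rewrite cats0.
move=> /run_consP[v hv hD2].
apply: (@eqv_trans _ ([:: offset_event (size s1) f; e] ++ offset (size u) D2)).
  exact: (eqv_catr _ (far_events hu hv)).
apply: (@eqv_catl _ (s1 ++ v) [:: offset_event (size s1) f]); last exact: IH.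
exact: act_framel.
Qed.

(** * Checking explicit isotopies *)

Definition moveb (u v : diagram) : bool :=
  match u, v with
  | [:: e; f], [:: f'; e'] =>
      [&& pos e + coarity e <= pos f,
          f' == at_pos f (pos f - coarity e + arity e) & e' == e]
      || match u, v with
         | [:: Cup i; Cross b j], [:: Cup i'; Cross b' j'] =>
             (v == [:: Cup i.+1; Cross (~~ b) i]) && (j == i.+1)
         | [:: Cross b j; Cap i], [:: Cross b' j'; Cap i'] =>
             (v == [:: Cross (~~ b) i; Cap i.+1]) && (j == i.+1)
         | _, _ => false
         end
  | [:: Cup i; Cap j], [::] => (j == i.+1) || (i == j.+1)
  | [:: Cross b i; Cross b' j], [::] => (j == i) && (b' == ~~ b)
  | [:: Cross b1 i; Cross b2 j; Cross b3 k], _ =>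
      [&& (b1 == b3) ==> (b2 == b1), j == i.+1, k == i
        & v == [:: Cross b3 i.+1; Cross b2 i; Cross b1 i.+1]]
  | _, _ => false
  end.

Lemma movebP (u v : diagram) : moveb u v -> move u v.
Proof.
have far e f f' e' : [&& pos e + coarity e <= pos f,
          f' == at_pos f (pos f - coarity e + arity e) & e' == e] ->
    move [:: e; f] [:: f'; e'].
  by case/and3P => h /eqP-> /eqP->; apply: move_far.
case: u => [|e [|f [|g [|? ?]]]] //.
- by case: e.
- case: v => [|f' [|e' [|? ?]]].
  + case: e => [i|i|b i]; case: f => [j|j|c j] //.
      by case/orP => /eqP->; [apply: move_snake_l|apply: move_snake_r].
    by case/andP => /eqP-> /eqP->; apply: move_R2.
  + by case: e => [?|?|? ?]; case: f.
  + case: e => [i|i|b i]; case: f => [j|j|c j]; (case/orP; first exact: far) => //;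
      case: f' => [?|?|? ?] //; case: e' => [?|?|? ?] // /andP[/eqP-> /eqP->].
      exact: move_cup_slide.
    exact: move_cap_slide.
  + by case: e => [?|?|? ?]; case: f.
- case: e => [?|?|b1 i] //; case: f => [?|?|b2 j] //; case: g => [?|?|b3 k] //.
  case/and4P=> h /eqP-> /eqP-> /eqP->.
  by apply: move_R3 => eq_b; apply/eqP; move: h; rewrite eq_b eqxx.
- by case: e => [?|?|? ?]; case: f => [?|?|? ?]; case: g.
Qed.

(** Both sides of a move have at most three events, whence the windows of lengths [a] and [b] below
    4; the move is tried in both directions. *)
Definition stepb (s : slice) (D D' : diagram) : bool :=
  (run D s == run D' s) &&
  has (fun k => has (fun a => has (fun b =>
     [&& take k D == take k D', drop (k + a) D == drop (k + b) D'
       & moveb (take a (drop k D)) (take b (drop k D'))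
         || moveb (take b (drop k D')) (take a (drop k D))])
     (iota 0 4)) (iota 0 4)) (iota 0 (size D).+1).

Lemma stepbP (s : slice) (D D' : diagram) : stepb s D D' -> eqv s D D'.
Proof.
case/andP => /eqP h /hasP[k _ /hasP[a _ /hasP[b _ /and3P[/eqP h1 /eqP h2 m]]]].
have e1 : D = take k D ++ take a (drop k D) ++ drop (k + a) D.
  by rewrite addnC -drop_drop !cat_take_drop.
have e2 : D' = take k D ++ take b (drop k D') ++ drop (k + a) D.
  by rewrite h1 h2 addnC -drop_drop !cat_take_drop.
case/orP: m => /movebP m; [|apply: eqv_sym]; apply: rst_step; split=> //.
  by exists (take a (drop k D)), (take b (drop k D')), (take k D), (drop (k + a) D).
by exists (take b (drop k D')), (take a (drop k D)), (take k D), (drop (k + a) D).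
Qed.

Lemma chain_eqv (s : slice) (D : diagram) (Ds : seq diagram) :
  path (stepb s) D Ds -> eqv s D (last D Ds).
Proof.
elim: Ds D => //= D' Ds IH D /andP[/stepbP h /IH].
exact: eqv_trans.
Qed.

(** * Sliding rings along a strand *)

Lemma eq_catP (T : Type) (l1 r1 l2 r2 : seq T) :
  l1 ++ r1 = l2 ++ r2 -> size l1 <= size l2 ->
  exists2 d, l2 = l1 ++ d & r1 = d ++ r2.
Proof.
elim: l1 l2 => [|x l1 IH] [|y l2] //=; try by exists [::]; rewrite ?H.
  by move=> -> _; exists (y :: l2).
by case=> -> /IH{}IH /IH[d -> ->]; exists d.
Qed.

(** The case analysis behind every slide along a strand: an event that does not stay on one side of
    the strand exchanges it with a neighbouring skein point. *)
Lemma act_strand_cases (e : event) (n : strand) (l r t : slice) :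
  act e (l ++ Some n :: r) = Some t ->
  [\/ exists2 l2, act e l = Some l2 & t = l2 ++ Some n :: r,
      exists f r2, [/\ e = offset_event (size l).+1 f, act f r = Some r2
                     & t = l ++ Some n :: r2],
      exists b (l1 : slice), [/\ l = rcons l1 None, e = Cross b (size l1)
                     & t = l1 ++ [:: Some n, None & r]]
    | exists b (r1 : slice), [/\ r = None :: r1, e = Cross b (size l)
                     & t = l ++ [:: None, Some n & r1]]].
Proof.
move=> /actP; move E: (l ++ _) => s h.
have right d m m' r' : act (at_pos e (size d)) (d ++ m ++ r') = Some (d ++ m' ++ r') ->
    pos e = size (l ++ Some n :: d) -> r = d ++ m ++ r' -> t = (l ++ Some n :: d) ++ m' ++ r' ->
    exists f r2, [/\ e = offset_event (size l).+1 f, act f r = Some r2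
                     & t = l ++ Some n :: r2].
  move=> ha hp -> ->; exists (at_pos e (size d)), (d ++ m' ++ r').
  rewrite -catA; split=> //.
  by case: (e) hp => [i|i|b i] /= ->; rewrite /offset_event /= size_cat /= addnS addSn.
case: h E right => [l' r'|l' r'|b l' x y r' hxy] E right.
- case: (leqP (size l') (size l)) => [le_l|lt_l].
    case: (eq_catP (esym E) le_l) => d -> ->.
    by apply: Or41; exists (l' ++ [:: None, None & d]); [apply/actP/acts_cup|rewrite -catA].
  rewrite -cat_rcons in E.
  case: (eq_catP E); rewrite ?size_rcons // => d el er.
  apply: Or42; apply: (right d [::] [:: None; None] r') => //.
  + by apply/actP/acts_cup.
  + by rewrite el cat_rcons.
  + by rewrite el cat_rcons.
- case: (leqP (size l') (size l)) => [le_l|lt_l].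
    case: (eq_catP (esym E) le_l) => -[|x [|y d]] // -> [] // ? ? -> ; subst x y.
    by apply: Or41; exists (l' ++ d); [apply/actP/acts_cap|rewrite -catA].
  rewrite -cat_rcons in E.
  case: (eq_catP E); rewrite ?size_rcons // => d el er.
  apply: Or42; apply: (right d [:: None; None] [::] r') => //.
  + by apply/actP/acts_cap.
  + by rewrite el cat_rcons.
  + by rewrite el cat_rcons.
- case: (leqP (size l') (size l)) => [le_l|lt_l].
    case: (eq_catP (esym E) le_l) => -[|x' [|y' d]] -> [].
    + move=> ? ?; subst x r; apply: Or44; exists b, r'.
      by move: hxy; rewrite cats0 /= => /eqP->.
    + move=> ? ? ?; subst x y r'; apply: Or43; exists b, l'.
      by move: hxy; rewrite orbF cats1 => /eqP->.
    + move=> ? ? ->; subst x' y'; apply: Or41; exists (l' ++ [:: y, x & d]).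
        by apply/actP/acts_cross.
      by rewrite -catA.
  rewrite -cat_rcons in E.
  case: (eq_catP E); rewrite ?size_rcons // => d el er.
  apply: Or42; apply: (right d [:: x; y] [:: y; x] r') => //.
  + by apply/actP/acts_cross.
  + by rewrite el cat_rcons.
  + by rewrite el cat_rcons.
Qed.

Lemma index_strand (n : strand) (l r : slice) :
  Some n \notin l -> index (Some n) (l ++ Some n :: r) = size l.
Proof. by move=> h; rewrite index_cat (negPf h) /= eqxx addn0. Qed.

Lemma split_strand (n : strand) (s : slice) : Some n \in s ->
  exists l r : slice, s = l ++ Some n :: r /\ Some n \notin l.
Proof.
elim: s => // x s IH; rewrite inE; case: eqVneq => [-> _|ne /= /IH[l [r [-> h]]]].
  by exists [::], s.
by exists (x :: l), r; rewrite inE negb_or ne h.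
Qed.

Lemma run_curve_x (n : strand) : run curve_x [:: Some n] = Some [:: Some n].
Proof. by case: n. Qed.

Lemma act_notin (n : strand) (e : event) (s t : slice) :
  act e s = Some t -> Some n \notin s -> Some n \notin t.
Proof.
move=> /actP[l r|l r|b l x y r _]; rewrite !mem_cat !inE //.
by rewrite (orbCA (Some n == x)).
Qed.

(** The skein line runs entirely in front of the strand and the ring, or entirely behind them,
    according to [b], so it can be swept across the ring: across its lower half in [h1], its upper
    half in [h2]. Intermediate words have self-crossings. *)
Lemma ring_cross (n b : bool) :
  eqv [:: None; Some n] (Cross b 0 :: curve_x) (offset 1 curve_x ++ [:: Cross b 0]).
Proof.
have h1 : eqv [:: None; Some n] [:: Cross b 0; Cup 0; Cross true 1]
    [:: Cup 1; Cross true 2; Cross b 0; Cross b 1; Cross b 2].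
  apply: (@chain_eqv _ _
    [:: [:: Cup 0; Cross b 2; Cross true 1];
      [:: Cup 0; Cross (~~ b) 1; Cross b 1; Cross b 2; Cross true 1];
      [:: Cup 1; Cross b 0; Cross b 1; Cross b 2; Cross true 1];
      [:: Cup 1; Cross b 0; Cross true 2; Cross b 1; Cross b 2];
      [:: Cup 1; Cross true 2; Cross b 0; Cross b 1; Cross b 2]]).
  by case: n; case: b.
have h2 : eqv [:: None; None; Some n; None]
    [:: Cross b 0; Cross b 1; Cross b 2; Cross true 1; Cap 0]
    [:: Cross true 2; Cap 1; Cross b 0].
  apply: (@chain_eqv _ _
    [:: [:: Cross b 0; Cross true 2; Cross b 1; Cross b 2; Cap 0];
      [:: Cross true 2; Cross b 0; Cross b 1; Cross b 2; Cap 0];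
      [:: Cross true 2; Cross b 0; Cross b 1; Cap 0; Cross b 0];
      [:: Cross true 2; Cross b 0; Cross (~~ b) 0; Cap 1; Cross b 0];
      [:: Cross true 2; Cap 1; Cross b 0]]).
  by case: (n); case: (b).
apply: eqv_trans (eqv_catr [:: Cross true 1; Cap 0] h1) _.
by apply: (@eqv_catl _ _ [:: Cup 1; Cross true 2]) h2; case: (n).
Qed.

Lemma cross_cancel (b : bool) (i : nat) (s t : slice) :
  act (Cross b i) s = Some t -> eqv s [:: Cross b i; Cross (~~ b) i] [::].
Proof.
move=> h; apply: eqv_move; first exact: move_R2.
by rewrite run_cons h /= run1 -[LHS]/(act (upside_down (Cross b i)) t) (act_upside_down h).
Qed.

Lemma ring_cross' (n b : bool) :
  eqv [:: Some n; None] (Cross b 0 :: offset 1 curve_x) (curve_x ++ [:: Cross b 0]).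
Proof.
have hx : run [:: Cross b 0] [:: Some n; None] = Some [:: None; Some n] by [].
have hx' : act (Cross (~~ b) 0) [:: None; Some n] = Some [:: Some n; None] by case: (n).
have h : eqv [:: None; Some n] (offset 1 curve_x)
           ([:: Cross (~~ b) 0] ++ curve_x ++ [:: Cross b 0]).
  apply: (@eqv_trans _ (offset 1 curve_x ++ [:: Cross (~~ b) 0; Cross (~~ ~~ b) 0])).
    apply/eqv_sym; rewrite -{2}[offset _ _]cats0; apply: eqv_catl (cross_cancel hx').
    by case: (n).
  have := eqv_catr [:: Cross b 0] (eqv_sym (ring_cross n (~~ b))).
  by rewrite -!catA negbK.
apply: eqv_trans (@eqv_catl _ _ [:: Cross b 0] _ _ hx h) _.
exact: (eqv_catr _ (cross_cancel hx)).
Qed.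

(** Events on one side of the strand commute with the ring by interchange; only crossings of this
    strand need the explicit isotopies. *)
Lemma ring_slide (n : strand) (e : event) (s t : slice) :
  Some n \in s -> act e s = Some t ->
  eqv s (e :: offset (index (Some n) t) curve_x)
    (offset (index (Some n) s) curve_x ++ [:: e]).
Proof.
move=> /split_strand[l [r [-> hl]]].
have rx := run_curve_x n.
case/act_strand_cases.
- case=> l2 he ->; rewrite !index_strand ?(act_notin he) //.
  have := @eqv_interchange [:: e] curve_x l l2 ([:: Some n] ++ r) ([:: Some n] ++ r) he.
  by apply; apply: run_framer rx.
- case=> f [r2 [-> hf ->]]; rewrite !index_strand //.
  have h := @eqv_interchange curve_x [:: f] [:: Some n] [:: Some n] r r2 rx hf.
  have := eqv_framel l (run_catS (run_framer r rx) (@run_framel [:: f] [:: Some n] _ _ hf)) h.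
  by rewrite !offset_cat /= !offset_eventD addn1 => /eqv_sym.
- case=> b [l1 [el -> ->]]; move: hl; rewrite el mem_rcons inE /= => hl.
  rewrite index_strand // -[rcons l1 _ ++ _]cat_rcons !cat_rcons.
  rewrite -[l1 ++ None :: _]cat_rcons index_strand ?mem_rcons ?inE // cat_rcons size_rcons.
  have hx : run (Cross b 0 :: curve_x) [:: None; Some n] = Some [:: Some n; None].
    by case: (n); case: (b).
  have := eqv_frame l1 r hx (ring_cross n b).
  by rewrite offset_cat offsetD /= /offset_event /= !addn0 !addn1.
- case=> b [r1 [-> -> ->]].
  rewrite -[l ++ None :: _]cat_rcons !index_strand ?mem_rcons ?inE // size_rcons.
  have hx : run (Cross b 0 :: offset 1 curve_x) [:: Some n; None] = Some [:: None; Some n].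
    by case: (n); case: (b).
  have := eqv_frame l r1 hx (ring_cross' n b).
  by rewrite offset_cat /= /offset_event /= !addn0 ?addn1 ?addn2.
Qed.

Lemma ring_slide_word (n : strand) (D : diagram) (s t : slice) :
  Some n \in s -> run D s = Some t ->
  eqv s (D ++ offset (index (Some n) t) curve_x)
    (offset (index (Some n) s) curve_x ++ D).
Proof.
elim: D s => [|e D IH] s hs; first by case=> <-; rewrite cats0.
move=> /run_consP[u hu hD].
have hu' : Some n \in u.
  by apply: contraLR hs; apply: act_notin (act_upside_down hu).
have h1 := @eqv_catl s u [:: e] _ _ hu (IH u hu' hD).
apply: eqv_trans h1 _; rewrite -[e :: D]cat1s catA.
exact: (eqv_catr D (ring_slide hs hu)).
Qed.

(** * Gathering the skein points to the left of the strands *)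

Definition points (s : slice) : nat := count (pred1 None) s.

Definition gather (s : slice) : slice := nseq (points s) None ++ filter isSome s.

(** One strand travels leftwards behind [m] skein points. *)
Definition pass_front (m : nat) : diagram := [seq Cross true i | i <- rev (iota 0 m)].

(** The leftmost entry is placed first, so that each strand is pulled behind exactly the skein
    points that end up on its right. *)
Fixpoint comb (s : slice) : diagram :=
  if s is x :: s' then
    (if x is Some _ then pass_front (points s') else [::]) ++ offset 1 (comb s')
  else [::].

Lemma pass_frontS (m : nat) :
  pass_front m.+1 = offset 1 (pass_front m) ++ [:: Cross true 0].
Proof.
rewrite /pass_front /= rev_cons map_rcons -cats1 /offset -map_comp.
by rewrite (iotaDl 1 0 m) -map_rev -map_comp.
Qed.

Lemma run_pass_front (n : strand) (m : nat) :
  run (pass_front m) (nseq m None ++ [:: Some n]) = Some (Some n :: nseq m None).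
Proof.
elim: m => // m IH; rewrite pass_frontS.
exact: run_catS (run_framel [:: None] IH) _.
Qed.

Lemma gather_some (n : strand) (s : slice) :
  gather (Some n :: s) = (nseq (points s) None ++ [:: Some n]) ++ filter isSome s.
Proof. by rewrite -catA. Qed.

Lemma run_comb (s : slice) : run (comb s) (gather s) = Some s.
Proof.
elim: s => // -[n|] s IH; last exact: (run_framel [:: None] IH).
rewrite gather_some; apply: run_catS (run_framer _ (run_pass_front n _)) _.
exact: (run_framel [:: Some n] IH).
Qed.

Definition plain (e : event) : bool := if e is Cross _ _ then false else true.

Lemma act_cup_nseq (i m : nat) : i <= m ->
  act (Cup i) (nseq m None) = Some (nseq m.+2 None).
Proof.
move=> /subnKC <-; apply/actP; have := acts_cup (nseq i None) (nseq (m - i) None).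
rewrite size_nseq -[[:: None, None & _]]/(nseq (m - i).+2 None) -!nseqD.
by rewrite !addnS.
Qed.

Lemma act_cap_nseq (i m : nat) : i <= m ->
  act (Cap i) (nseq m.+2 None) = Some (nseq m None).
Proof. by move=> /act_cup_nseq/act_upside_down. Qed.

(** For [i = 0] the cup is next to the strand, and an R2 move and a cup slide let it be born on the
    other side. For larger [i] the last crossing of [pass_front] does not meet the cup, and
    induction applies. *)
Lemma pass_front_cup (n : strand) (i m : nat) : i <= m ->
  eqv (nseq m None ++ [:: Some n])
    (pass_front m ++ [:: Cup i.+1]) (Cup i :: pass_front m.+2).
Proof.
elim: i m => [|i IH] m le_im.
  have hx : run [:: Cup 1] [:: Some n] = Some [:: Some n; None; None] by [].
  have hp := run_pass_front n m.
  have h : eqv [:: Some n] [:: Cup 1] [:: Cup 0; Cross true 1; Cross true 0].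
    apply: (@chain_eqv _ _ [:: [:: Cup 1; Cross false 0; Cross true 0];
                               [:: Cup 0; Cross true 1; Cross true 0]]).
    by case: (n).
  have := eqv_catl hp (eqv_framer (nseq m None) hx h).
  move/eqv_trans; apply.
  have := @eqv_interchange [:: Cup 0] _ [::] [:: None; None] _ _ (erefl _) hp.
  move=> /(eqv_catr [:: Cross true 1; Cross true 0])/eqv_sym.
  by rewrite -catA !pass_frontS !offset_cat !offsetD offset0 -!catA.
case: m le_im => // m le_im.
have hp := run_framel [:: None] (run_pass_front n m).
have hc : act (Cup i) (nseq m None) = Some (nseq m.+2 None) by apply: act_cup_nseq.
rewrite (pass_frontS m) -catA.
have := far_events (erefl : act (Cross true 0) [:: None; Some n] = Some _) hc.
move=> /(eqv_catl hp)/eqv_trans; apply.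
rewrite -[offset _ (pass_front _) ++ _]cat_rcons -[rcons (offset _ _) _]cats1.
rewrite (pass_frontS m.+2) -cat_cons; apply: eqv_catr.
have := IH m le_im.
have hr : run (pass_front m ++ [:: Cup i.+1]) (nseq m None ++ [:: Some n]) =
    Some (Some n :: nseq m.+2 None).
  apply: run_catS (run_pass_front n m) _.
  exact: (act_framel [:: Some n] hc).
by move=> /(eqv_framel [:: None] hr); rewrite offset_cat.
Qed.

Lemma pass_front_cap (n : strand) (i m : nat) : i <= m ->
  eqv (nseq m.+2 None ++ [:: Some n])
    (pass_front m.+2 ++ [:: Cap i.+1]) (Cap i :: pass_front m).
Proof.
elim: i m => [|i IH] m le_im.
  have hx : run [:: Cross true 1; Cross true 0; Cap 1] [:: None; None; Some n] =
    Some [:: Some n] by [].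
  have hp := run_pass_front n m.
  have h : eqv [:: None; None; Some n] [:: Cross true 1; Cross true 0; Cap 1] [:: Cap 0].
    apply: (@chain_eqv _ _ [:: [:: Cross true 1; Cross false 1; Cap 0];
                               [:: Cap 0]]).
    by case: (n).
  have hp2 := run_framel [:: None; None] hp.
  have := eqv_catl hp2 (eqv_framer (nseq m None) hx h).
  rewrite !pass_frontS !offset_cat !offsetD -!catA => /eqv_trans; apply.
  have := @eqv_interchange [:: Cap 0] _ [:: None; None] [::] _ _ (erefl _) hp.
  by rewrite /= offset0 => /eqv_sym.
case: m le_im => // m le_im.
have hp := run_framel [:: None] (run_pass_front n m.+2).
have hc : act (Cap i) (nseq m.+2 None) = Some (nseq m None) by apply: act_cap_nseq.
rewrite (pass_frontS m.+2) -catA.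
have := far_events (erefl : act (Cross true 0) [:: None; Some n] = Some _) hc.
move=> /(eqv_catl hp)/eqv_trans; apply.
rewrite -[offset _ (pass_front _) ++ _]cat_rcons -[rcons (offset _ _) _]cats1.
rewrite (pass_frontS m) -cat_cons; apply: eqv_catr.
have := IH m le_im.
have hr : run (pass_front m.+2 ++ [:: Cap i.+1]) (nseq m.+2 None ++ [:: Some n]) =
    Some (Some n :: nseq m None).
  apply: run_catS (run_pass_front n m.+2) _.
  exact: (act_framel [:: Some n] hc).
by move=> /(eqv_framel [:: None] hr); rewrite offset_cat.
Qed.

Lemma act_plain_nseq (e : event) (m : nat) (t : slice) :
  plain e -> act e (nseq m None) = Some t ->
  t = nseq (size t) None /\
  ((exists2 i, e = Cup i & i <= m /\ size t = m.+2) \/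
   (exists2 i, e = Cap i & i <= size t /\ m = (size t).+2)).
Proof.
move=> pe /actP; move E: (nseq m None) => s h.
have hs : all (pred1 None) s by rewrite -E all_pred1_nseq.
have sz : size s = m by rewrite -E size_nseq.
case: h hs sz pe {E} => [l r|l r|//] hs <- _; (split; first apply/all_pred1P).
- by move: hs; rewrite !all_cat.
- by left; exists (size l); rewrite // !size_cat /= !addnS leq_addr.
- by move: hs; rewrite !all_cat.
- by right; exists (size l); rewrite // !size_cat /= !addnS leq_addr.
Qed.

Lemma pass_front_word (n : strand) (f : diagram) (c c' : nat) :
  all plain f -> run f (nseq c None) = Some (nseq c' None) ->
  eqv (nseq c None ++ [:: Some n])
    (pass_front c ++ offset 1 f) (f ++ pass_front c').
Proof.
elim: f c => [|e f IH] c /=.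
  by move=> _ [/(congr1 size)]; rewrite !size_nseq cats0 => ->.
case/andP=> pe pf /run_consP[t he hf].
case: (act_plain_nseq pe he) => et hi; rewrite et in he hf.
have {}IH := IH _ pf hf.
have h1 : eqv (nseq c None ++ [:: Some n])
    (pass_front c ++ [:: offset_event 1 e]) (e :: pass_front (size t)).
  case: hi => -[i ? [le_i]]; subst e; [move=> -> | move=> e_c; subst c].
    exact: pass_front_cup.
  exact: pass_front_cap.
rewrite -[offset_event 1 e :: _]cat1s catA.
apply: eqv_trans (eqv_catr _ h1) _.
have he' : run [:: e] (nseq c None ++ [:: Some n]) = Some (nseq (size t) None ++ [:: Some n]).
  exact: act_framer he.
exact: (eqv_catl he' IH).
Qed.

Lemma points_cat (s t : slice) : points (s ++ t) = points s + points t.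
Proof. exact: count_cat. Qed.

(** Reduces the passage of an event through the comb to slices that begin at the event: a further
    skein point on the left only shifts the words, and a further strand is passed by
    [pass_front_word], which is why [f] has to consist of cups and caps. *)
Lemma comb_prefix (l s t : slice) (e : event) (f : diagram) :
  filter isSome s = filter isSome t -> all plain f ->
  run f (nseq (points s) None) = Some (nseq (points t) None) ->
  act e s = Some t -> eqv (gather s) (comb s ++ [:: e]) (f ++ comb t) ->
  eqv (gather (l ++ s)) (comb (l ++ s) ++ [:: offset_event (size l) e])
    (offset (points l) f ++ comb (l ++ t)).
Proof.
move=> est pf hf he h; elim: l => [|x l IH].
  by rewrite offset_event0 offset0.
have hr : run (comb (l ++ s) ++ [:: offset_event (size l) e]) (gather (l ++ s)) = Some (l ++ t).
  by apply: run_catS (run_comb _) _; apply: act_framel.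
case: x => [n|] /=; last first.
  have := eqv_framel [:: None] hr IH.
  by rewrite !offset_cat /= !offset_eventD !offsetD.
rewrite -catA.
have -> : offset 1 (comb (l ++ s)) ++ [:: offset_event (size l).+1 e] =
   offset 1 (comb (l ++ s) ++ [:: offset_event (size l) e]).
  by rewrite offset_cat /= offset_eventD.
have hp := run_pass_front n (points (l ++ s)).
have hp' := run_framer (filter isSome (l ++ s)) hp.
rewrite gather_some.
apply: eqv_trans (eqv_catl hp' (eqv_framel [:: Some n] hr IH)) _.
rewrite offset_cat !catA; apply: eqv_catr.
have hf' : run (offset (points l) f) (nseq (points (l ++ s)) None) =
           Some (nseq (points (l ++ t)) None).
  have := run_framel (nseq (points l) None) hf.
  by rewrite size_nseq -!nseqD !points_cat.
apply: eqv_framer; last first.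
  apply: pass_front_word hf'.
  by rewrite all_map; apply: sub_all pf => -[].
apply: run_catS hp _.
exact: (run_framel [:: Some n] hf').
Qed.

Lemma comb_cup (l r : slice) :
  eqv (gather (l ++ r)) (comb (l ++ r) ++ [:: Cup (size l)])
    (Cup (points l) :: comb (l ++ [:: None, None & r])).
Proof.
have h : eqv (gather r) (comb r ++ [:: Cup 0]) ([:: Cup 0] ++ comb [:: None, None & r]).
  have := @eqv_interchange [:: Cup 0] _ [::] [:: None; None] _ _ (erefl _) (run_comb r).
  by rewrite /= offsetD offset0 => /eqv_sym.
have hr : act (Cup 0) r = Some [:: None, None & r] by rewrite /= take0 drop0.
have := @comb_prefix l r [:: None, None & r] (Cup 0) [:: Cup 0] (erefl _) isT
  (act_cup_nseq (leq0n _)) hr h.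
by rewrite /offset_event /= !addn0.
Qed.

Lemma comb_cap (l r : slice) :
  eqv (gather (l ++ [:: None, None & r]))
    (comb (l ++ [:: None, None & r]) ++ [:: Cap (size l)])
    (Cap (points l) :: comb (l ++ r)).
Proof.
have h : eqv (gather [:: None, None & r]) (comb [:: None, None & r] ++ [:: Cap 0])
    ([:: Cap 0] ++ comb r).
  have := @eqv_interchange [:: Cap 0] _ [:: None; None] [::] _ _ (erefl _) (run_comb r).
  by rewrite /= offsetD offset0 => /eqv_sym.
have hr : act (Cap 0) [:: None, None & r] = Some r by apply/actP; exact: (acts_cap [::] r).
have := @comb_prefix l [:: None, None & r] r (Cap 0) [:: Cap 0] (erefl _) isT
  (act_cap_nseq (leq0n _)) hr h.
by rewrite /offset_event /= !addn0.
Qed.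

(** Both slices gather to the same one, and the new crossing is the last tooth of the longer comb,
    up to an interchange. *)
Lemma comb_right (n : strand) (l r : slice) :
  eqv (gather (l ++ [:: None, Some n & r]))
    (comb (l ++ [:: None, Some n & r]) ++ [:: Cross true (size l)])
    (comb (l ++ [:: Some n, None & r])).
Proof.
have h : eqv (gather [:: None, Some n & r])
   (comb [:: None, Some n & r] ++ [:: Cross true 0]) (comb [:: Some n, None & r]).
  have hp := run_framer (filter isSome r) (run_framel [:: None] (run_pass_front n (points r))).
  have := @eqv_interchange [:: Cross true 0] _ [:: None; Some n] [:: Some n; None] _ _
    (erefl _) (run_comb r).
  move=> /(eqv_catl hp)/eqv_sym.
  rewrite /= offset_cat !offsetD -!catA => /eqv_trans; apply.
  by rewrite add1n pass_frontS -catA.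
have := @comb_prefix l [:: None, Some n & r] [:: Some n, None & r] (Cross true 0) [::]
  (erefl _) isT (erefl _) (erefl _) h.
by rewrite /offset_event /= !addn0.
Qed.

Lemma comb_left (n : strand) (l r : slice) :
  eqv (gather (l ++ [:: Some n, None & r]))
    (comb (l ++ [:: Some n, None & r]) ++ [:: Cross false (size l)])
    (comb (l ++ [:: None, Some n & r])).
Proof.
have -> : gather (l ++ [:: Some n, None & r]) = gather (l ++ [:: None, Some n & r]).
  by rewrite /gather !filter_cat !points_cat.
apply: eqv_trans (eqv_catr _ (eqv_sym (comb_right n l r))) _.
rewrite -catA -[X in eqv _ _ X]cats0.
apply: eqv_catl (run_comb _) _.
by apply: cross_cancel; apply/actP/acts_cross.
Qed.

(** * Crossings of a word with the strands *)

(** Heights refer to a whole diagram and do not split along concatenations. The versions here are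
    read from a starting slice; [crossings_iota] and [clean_iota] lead back to heights. *)
Definition crossing_of (s : slice) (e : event) : option (strand * bool) :=
  if e is Cross b i then
    match drop i s with
    | None :: Some n :: _ => Some (n, b)
    | Some n :: None :: _ => Some (n, ~~ b)
    | _ => None
    end
  else None.

Fixpoint crossings (s : slice) (D : diagram) : seq (strand * bool) :=
  if D is e :: D' then
    seq_of_opt (crossing_of s e) ++ crossings (odflt s (act e s)) D'
  else [::].

Fixpoint clean (s : slice) (D : diagram) : bool :=
  if D is e :: D' then ~~ self_crossing s e && clean (odflt s (act e s)) D'
  else true.

Lemma crossings_cons (s t : slice) (e : event) (D : diagram) :
  act e s = Some t ->
  crossings s (e :: D) = seq_of_opt (crossing_of s e) ++ crossings t D.
Proof. by move=> /= ->. Qed.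

Lemma clean_cons (s t : slice) (e : event) (D : diagram) :
  act e s = Some t -> clean s (e :: D) = ~~ self_crossing s e && clean t D.
Proof. by move=> /= ->. Qed.

Lemma crossings_cat (s t : slice) (D1 D2 : diagram) :
  run D1 s = Some t -> crossings s (D1 ++ D2) = crossings s D1 ++ crossings t D2.
Proof.
elim: D1 s => [|e D1 IH] s; first by case=> ->.
move=> /run_consP[u hu /IH h].
by rewrite cat_cons !(crossings_cons _ hu) h catA.
Qed.

Lemma clean_cat (s t : slice) (D1 D2 : diagram) :
  run D1 s = Some t -> clean s (D1 ++ D2) = clean s D1 && clean t D2.
Proof.
elim: D1 s => [|e D1 IH] s; first by case=> ->.
move=> /run_consP[u hu /IH h].
by rewrite cat_cons !(clean_cons _ hu) h andbA.
Qed.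

(** The events of a skein term. Crossings are sorted by [o], over or under, rather than by the flag
    of [Cross], whose meaning depends on the direction. *)
Inductive clean_acts : event -> slice -> slice -> option (strand * bool) -> Prop :=
| clean_cup (l r : slice) :
    clean_acts (Cup (size l)) (l ++ r) (l ++ [:: None, None & r]) None
| clean_cap (l r : slice) :
    clean_acts (Cap (size l)) (l ++ [:: None, None & r]) (l ++ r) None
| clean_right (o : bool) n (l r : slice) :
    clean_acts (Cross o (size l)) (l ++ [:: None, Some n & r])
      (l ++ [:: Some n, None & r]) (Some (n, o))
| clean_left (o : bool) n (l r : slice) :
    clean_acts (Cross (~~ o) (size l)) (l ++ [:: Some n, None & r])
      (l ++ [:: None, Some n & r]) (Some (n, o)).

Lemma clean_actsP (e : event) (s t : slice) :
  act e s = Some t -> ~~ self_crossing s e -> clean_acts e s t (crossing_of s e).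
Proof.
move=> /actP[l r|l r|b l x y r h] hs.
- exact: clean_cup.
- exact: clean_cap.
move: hs h; rewrite /= !drop_size_cat //= take0.
case: x y => [n|] [n'|] //= _ _.
- by rewrite -{1}[b]negbK; exact: (clean_left (~~ b) n l r).
- exact: (clean_right b n' l r).
Qed.

Lemma clean_acts_act (e : event) (s t : slice) c :
  clean_acts e s t c -> act e s = Some t.
Proof. by case=> *; apply/actP; constructor. Qed.

Lemma clean_actsE (e : event) (s t : slice) c :
  clean_acts e s t c -> ~~ self_crossing s e /\ crossing_of s e = c.
Proof. by case=> * //=; rewrite !drop_size_cat //= ?negbK. Qed.

(** * Words passing in front of the strands *)

Lemma front_event (e : event) (s t : slice) (c : option (strand * bool)) :
  clean_acts e s t c -> (if c is Some (_, o) then o else true) ->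
  exists f, [/\ all plain f,
    run f (nseq (points s) None) = Some (nseq (points t) None)
    & eqv (gather s) (comb s ++ [:: e]) (f ++ comb t)].
Proof.
case=> [l r|l r|o n l r|o n l r] ho.
- exists [:: Cup (points l)]; split=> //; last exact: comb_cup.
  by rewrite !points_cat /= !addnS; apply: act_cup_nseq; apply: leq_addr.
- exists [:: Cap (points l)]; split=> //; last exact: comb_cap.
  by rewrite !points_cat /= !addnS; apply: act_cap_nseq; apply: leq_addr.
- by exists [::]; rewrite ho !points_cat; split=> //; apply: comb_right.
- by exists [::]; rewrite ho !points_cat; split=> //; apply: comb_left.
Qed.

Lemma run_gather (f : diagram) (s t : slice) :
  filter isSome s = filter isSome t ->
  run f (nseq (points s) None) = Some (nseq (points t) None) ->
  run f (gather s) = Some (gather t).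
Proof. by rewrite /gather => ->; apply: run_framer. Qed.

Lemma act_strands (e : event) (s t : slice) :
  act e s = Some t -> filter isSome s = filter isSome t.
Proof.
move=> /actP[l r|l r|b l x y r h]; rewrite !filter_cat //=.
by case: x y h => [?|] [?|].
Qed.

Lemma run_strands (D : diagram) (s t : slice) :
  run D s = Some t -> filter isSome s = filter isSome t.
Proof.
elim: D s => [|e D IH] s; first by case=> ->.
by move=> /run_consP[u /act_strands-> /IH].
Qed.

(** Each event is pushed down into the comb: a cup or cap comes out below it among the gathered
    points, an overcrossing is absorbed. *)
Lemma front_word (D : diagram) (s t : slice) :
  run D s = Some t -> clean s D -> all snd (crossings s D) ->
  exists f, [/\ all plain f,
    run f (nseq (points s) None) = Some (nseq (points t) None)
    & eqv (gather s) (comb s ++ D) (f ++ comb t)].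
Proof.
elim: D s => [|e D IH] s.
  by case=> <- _ _; exists [::]; rewrite cats0.
move=> /run_consP[u hu hD]; rewrite (clean_cons _ hu) (crossings_cons _ hu) all_cat.
case/andP=> /(clean_actsP hu) he cD /andP[oe oD].
case: (IH u hD cD oD) => f' [pf' hf' h'].
case: (front_event he).
  by case: crossing_of oe => // -[n o] /= /andP[].
move=> f [pf hf h]; exists (f ++ f'); split.
- by rewrite all_cat pf.
- exact: run_catS hf hf'.
rewrite -[e :: D]cat1s catA.
apply: eqv_trans (eqv_catr _ h) _; rewrite -!catA.
exact: eqv_catl (run_gather (act_strands hu) hf) h'.
Qed.

(** * Diagrams of cups *)

Definition cups (c : seq nat) : diagram := map Cup c.
Definition loops (a : nat) : diagram := flatten (nseq a unknot).

Lemma cups_rcons (c : seq nat) (i : nat) : cups (rcons c i) = cups c ++ [:: Cup i].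
Proof. by rewrite /cups map_rcons cats1. Qed.

Lemma run_loops (a : nat) (s : slice) : run (loops a) s = Some s.
Proof.
elim: a => // a IH; apply: (@run_catS unknot _ _ s) IH.
have hc : act (Cup 0) s = Some [:: None, None & s] by rewrite /= take0 drop0.
by rewrite /unknot run_cons hc /= run1 (act_upside_down hc).
Qed.

(** The circle is pulled leftwards in front of one point after the other, be it strand or skein. *)
Lemma loop_pos (i : nat) (s : slice) : i <= size s -> eqv s [:: Cup i; Cap i] unknot.
Proof.
elim: i s => [|i IH] s //.
case: s => // x s le_i; apply: (@eqv_trans _ [:: Cup 1; Cap 1]).
  have hr : run [:: Cup i; Cap i] s = Some s.
    have h : act (Cup i) s = Some (take i s ++ [:: None; None] ++ drop i s).
      by rewrite /= (le_i : i <= size s).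
    by rewrite run_cons h /= run1 (act_upside_down h).
  exact: (eqv_framel [:: x] hr (IH _ le_i)).
apply: (@eqv_framer _ _ [:: x] [:: x]) => //; apply: eqv_sym.
apply: (@chain_eqv _ _ [:: [:: Cup 0; Cross true 1; Cross false 1; Cap 0];
   [:: Cup 1; Cross false 0; Cross false 1; Cap 0];
   [:: Cup 1; Cross false 0; Cross true 0; Cap 1]; [:: Cup 1; Cap 1]]).
by case: (x) => [[]|].
Qed.

Lemma unknot_slide (D : diagram) (s t : slice) :
  run D s = Some t -> eqv s (D ++ unknot) (unknot ++ D).
Proof.
move=> hD; have := @eqv_interchange unknot D [::] [::] s t (erefl _) hD.
by rewrite /= !offset0 => /eqv_sym.
Qed.

Lemma run2 (e f : event) (s t u : slice) :
  act e s = Some t -> act f t = Some u -> run [:: e; f] s = Some u.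
Proof. by move=> he; rewrite run_cons he. Qed.

Lemma run_plain_nseq (f : diagram) (m : nat) (t : slice) :
  all plain f -> run f (nseq m None) = Some t -> t = nseq (size t) None.
Proof.
elim: f m => [|e f IH] m; first by move=> _ [<-]; rewrite size_nseq.
case/andP=> pe pf /run_consP[u /(act_plain_nseq pe)[-> _]].
exact: IH.
Qed.

Lemma run_cups_rcons (c : seq nat) (i m : nat) :
  run (cups (rcons c i)) [::] = Some (nseq m None) ->
  exists m', [/\ m = m'.+2, i <= m' & run (cups c) [::] = Some (nseq m' None)].
Proof.
rewrite cups_rcons => /run_catP[u hu].
have eu : u = nseq (size u) None
  by apply: (@run_plain_nseq (cups c) 0) hu; rewrite all_map all_predT.
rewrite eu run1 => h.
case: (act_plain_nseq _ h) => // _ [] [j [//]]; rewrite size_nseq => <- [le_i ->].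
by exists (size u); split=> //; rewrite hu -eu.
Qed.

Lemma run_cups_size (c : seq nat) (m : nat) :
  run (cups c) [::] = Some (nseq m None) -> m = (size c).*2.
Proof.
elim/last_ind: c m => [|c i IH] m; first by case=> /(congr1 size); rewrite size_nseq.
by case/run_cups_rcons=> m' [-> _ /IH->]; rewrite size_rcons doubleS.
Qed.

(** Compare the cap with the last cup: sharing both legs they close a circle, sharing one they
    cancel as a snake, and otherwise the cap moves below the cup and induction applies. *)
Lemma cups_cap (c : seq nat) (i m : nat) :
  run (cups c) [::] = Some (nseq m.+2 None) -> i <= m ->
  exists a c', eqv [::] (cups c ++ [:: Cap i]) (loops a ++ cups c').
Proof.
elim/last_ind: c i m => [|c j IH] i m //.
case/run_cups_rcons=> _ [[<-] le_j hc] le_i.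
rewrite cups_rcons -catA /=.
have cupm k : k <= m -> act (Cup k) (nseq m None) = Some (nseq m.+2 None).
  exact: act_cup_nseq.
have capm k : k <= m -> act (Cap k) (nseq m.+2 None) = Some (nseq m None).
  exact: act_cap_nseq.
case: (ltngtP i j) => [lt_ij|lt_ji|eq_ij]; last first.
- exists 1, c; rewrite eq_ij.
  apply: eqv_trans (unknot_slide hc); apply: eqv_catl hc _.
  by apply: loop_pos; rewrite size_nseq.
- have [lt_ji2|] := ltnP j.+1 i; last first.
    move=> le_ij; have -> : i = j.+1 by lia.
    exists 0, c; rewrite -[X in eqv _ _ X]cats0; apply: eqv_catl hc _.
    apply: eqv_move; first exact: move_snake_l.
    apply: (run2 (cupm j le_j)); apply: capm; lia.
  have [m' em] : exists m', m = m'.+2 by exists m.-2; lia.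
  rewrite em in hc.
  have le_i2 : i - 2 <= m' by lia.
  case: (IH _ _ hc le_i2) => a [c' h]; exists a, (rcons c' j).
  rewrite cups_rcons catA; apply: eqv_trans (eqv_catr _ h); rewrite -catA /=.
  apply: eqv_catl hc _; rewrite -em; apply: eqv_move.
    by have := @move_far (Cup j) (Cap i); rewrite /= addn0 addn2; apply.
  rewrite (run2 (cupm j le_j) (capm i le_i)) em.
  by symmetry; apply: (@run2 _ _ _ (nseq m' None)); [apply: act_cap_nseq|apply: act_cup_nseq]; lia.
- have [lt_ij2|] := ltnP i.+1 j; last first.
    move=> le_ij; have -> : j = i.+1 by lia.
    exists 0, c; rewrite -[X in eqv _ _ X]cats0; apply: eqv_catl hc _.
    apply: eqv_move; first exact: move_snake_r.
    apply: (@run2 _ _ _ (nseq m.+2 None)); [apply: cupm|apply: capm]; lia.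
  have [m' em] : exists m', m = m'.+2 by exists m.-2; lia.
  rewrite em in hc.
  have le_i2 : i <= m' by lia.
  case: (IH _ _ hc le_i2) => a [c' h]; exists a, (rcons c' (j - 2)).
  rewrite cups_rcons catA; apply: eqv_trans (eqv_catr _ h); rewrite -catA /=.
  apply: eqv_catl hc _; rewrite -em; apply/eqv_sym; apply: eqv_move.
    have := @move_far (Cap i) (Cup (j - 2)); rewrite /= addn0 subn0 subnK; last by lia.
    by apply; lia.
  rewrite (run2 (cupm j le_j) (capm i le_i)) em.
  by apply: (@run2 _ _ _ (nseq m' None)); [apply: act_cap_nseq|apply: act_cup_nseq]; lia.
Qed.

Lemma plain_word (f : diagram) (m : nat) :
  all plain f -> run f [::] = Some (nseq m None) ->
  exists a c, eqv [::] f (loops a ++ cups c).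
Proof.
elim/last_ind: f m => [|f e IH] m; first by exists 0, [::].
rewrite all_rcons -cats1 => /andP[pe pf] /run_catP[u hu]; rewrite run1 => he.
have eu : u = nseq (size u) None by apply: (@run_plain_nseq f 0) hu.
rewrite eu in hu he; case: (IH _ pf hu) => a [c h].
have hl := eqv_run h; rewrite hu run_cat run_loops /= in hl.
case: (act_plain_nseq pe he) => _ [[i -> _]|[i -> [le_i eu2]]].
  by exists a, (rcons c i); rewrite cups_rcons catA; apply: eqv_catr.
rewrite size_nseq in le_i eu2; rewrite eu2 in hl.
case: (cups_cap (esym hl) le_i) => a' [c' h']; exists (a + a'), c'.
apply: eqv_trans (eqv_catr _ h) _.
rewrite /loops nseqD flatten_cat -!catA.
exact: eqv_catl (run_loops a [::]) h'.
Qed.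

(** The second cup lies inside the first exactly when [j = i.+1]; otherwise they may be born in the
    other order, and [i'] is where the first one then sits at the end. *)
Lemma cups_swap (c : seq nat) (i j m : nat) :
  run (cups (rcons (rcons c i) j)) [::] = Some (nseq m None) -> i.+1 != j ->
  exists i' j', eqv [::] (cups (rcons (rcons c i) j)) (cups (rcons (rcons c j') i')) /\
     i' = (if j <= i then i.+2 else i).
Proof.
move=> h ne; have [m1 [_ le_j h1]] := run_cups_rcons h.
have [m2 [e1 le_i h2]] := run_cups_rcons h1.
have cupm k : k <= m2 -> act (Cup k) (nseq m2 None) = Some (nseq m2.+2 None).
  exact: act_cup_nseq.
have cupm2 k : k <= m2.+2 -> act (Cup k) (nseq m2.+2 None) = Some (nseq m2.+4 None).
  exact: act_cup_nseq.
have [le_ji|lt_ij] := leqP j i.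
  exists i.+2, j; split=> //; rewrite !cups_rcons -!catA; apply: eqv_catl h2 _.
  apply/eqv_sym/eqv_move.
    by have := @move_far (Cup j) (Cup i.+2); rewrite /= addn0 addn2 !subSS subn0; apply.
  rewrite (run2 (cupm j _) (cupm2 i.+2 _)) ?(run2 (cupm i _) (cupm2 j _)) //; lia.
exists i, (j - 2); split=> //; rewrite !cups_rcons -!catA; apply: eqv_catl h2 _.
apply/eqv_move.
  by have := @move_far (Cup i) (Cup j); rewrite /= addn0 addn2; apply; lia.
by rewrite (run2 (cupm i _) (cupm2 j _)) ?(run2 (cupm (j - 2) _) (cupm2 i _)) //; lia.
Qed.

(** When no innermost cup avoids the cut [w], the cups form a rainbow centered at
    [w], whence [w = size c]. *)
Lemma cups_cut (c : seq nat) (m w : nat) :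
  run (cups c) [::] = Some (nseq m None) -> 0 < size c ->
  exists c' i, eqv [::] (cups c) (cups (rcons c' i)) /\
    (i.+1 != w \/ (i.+1 = w /\ w = size c)).
Proof.
elim/last_ind: c m w => [|c i IH] m w // h _.
have [ew|ne_w] := eqVneq i.+1 w; last by exists c, i; split=> //; left.
have [m1 [em le_i h1]] := run_cups_rcons h.
have [c0|c_gt0] := posnP (size c).
  exists c, i; split=> //; right; rewrite size_rcons c0 -ew; split=> //.
  by move: le_i; rewrite (run_cups_size h1) c0 leqn0 => /eqP->.
(* Before the last cup is born, the cut between its legs is the gap at [i]. *)
case: (IH _ i h1 c_gt0) => c' [i' [hc hi']].
(* Either the earlier cups form a rainbow at this gap, and the last cup completes it to a larger
   one, or some earlier cup does not enclose the last one directly and can be made the last. *)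
case: hi' => [ne|[_ ei]]; last first.
  by exists c, i; split=> //; right; rewrite size_rcons -ei ew.
have hc2 := eqv_catr [:: Cup i] hc; rewrite -!cups_rcons in hc2.
rewrite (eqv_run hc2) in h.
case: (cups_swap h ne) => i2 [j2 [h2 ei2]].
exists (rcons c' j2), i2; split; first exact: eqv_trans hc2 h2.
left; rewrite ei2 -ew eqSS; case: leqP; lia.
Qed.

(** * Pulling out the fundamental curves *)

Definition curves : seq diagram := [:: curve_x; curve_y; curve_z; unknot].

(** The curves may come in any order, which makes this closed under concatenation and half turns;
    [good_parallel] puts them in order. *)
Definition good (D : diagram) : Prop :=
  exists2 cs, all [in curves] cs & eqv empty_slice D (flatten cs).

Lemma run_curve (c : diagram) : c \in curves -> run c empty_slice = Some empty_slice.
Proof. by rewrite !inE => /or4P[] /eqP->. Qed.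

Lemma run_flatten (cs : seq diagram) :
  all [in curves] cs -> run (flatten cs) empty_slice = Some empty_slice.
Proof. by elim: cs => //= c cs IH /andP[/run_curve hc /IH]; apply: run_catS hc. Qed.

(** Each of the four curves is its own half turn. *)
Lemma half_turn_flatten (cs : seq diagram) :
  all [in curves] cs -> half_turn (flatten cs) = flatten (rev cs).
Proof.
elim: cs => //= c cs IH /andP[hc /IH]; rewrite half_turn_cat rev_cons -cats1 flatten_cat => ->.
by congr (_ ++ _); move: hc; rewrite /= cats0 !inE => /or4P[] /eqP->.
Qed.

Lemma good_eqv (D D' : diagram) : eqv empty_slice D D' -> good D' -> good D.
Proof. by move=> h [cs hcs h']; exists cs => //; apply: eqv_trans h h'. Qed.

Lemma good_cat (D D' : diagram) : good D -> good D' -> good (D ++ D').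
Proof.
move=> [cs hcs h] [cs' hcs' h']; exists (cs ++ cs'); first by rewrite all_cat hcs.
rewrite flatten_cat; apply: (eqv_cat _ h h').
by rewrite (eqv_run h) run_flatten.
Qed.

Lemma good_curve (c : diagram) : c \in curves -> good c.
Proof. by exists [:: c]; rewrite /= ?cats0 ?H. Qed.

Lemma good_loops (a : nat) : good (loops a).
Proof. by exists (nseq a unknot); rewrite // all_nseq !inE orbT. Qed.

Lemma good_half_turn (D : diagram) : good D -> good (half_turn D).
Proof.
move=> [cs hcs h]; exists (rev cs); first by rewrite all_rev.
rewrite -half_turn_flatten //; apply: (eqv_half_turn _ h).
by rewrite (eqv_run h) run_flatten.
Qed.

(** ** The curve around both strands *)

(** As in [ring_cross], a skein line running in front of everything is swept across the lower half
    of the ring ([h1]) and the upper half ([h2]). It must pass both strands: between them it would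
    block the ring. *)
Lemma curve_y_cross :
  eqv [:: None; Some strand1; Some strand2]
    ([:: Cross true 0; Cross true 1] ++ curve_y)
    (offset 1 curve_y ++ [:: Cross true 0; Cross true 1]).
Proof.
have h1 : eqv [:: None; Some strand1; Some strand2]
    [:: Cross true 0; Cross true 1; Cup 0; Cross true 1; Cross true 2]
    [:: Cup 1; Cross true 2; Cross true 3; Cross true 0; Cross true 1; Cross true 2; Cross true 3].
  by apply: (@chain_eqv _ _ [::
   [:: Cross true 0; Cup 0; Cross true 3; Cross true 1; Cross true 2];
   [:: Cross true 0; Cup 0; Cross true 3; Cross true 1; Cross true 2; Cross false 3; Cross true 3];
   [:: Cup 0; Cross true 2; Cross true 3; Cross true 1; Cross true 2; Cross false 3; Cross true 3];
   [:: Cup 0; Cross true 2; Cross true 1; Cross true 3; Cross true 2; Cross false 3; Cross true 3];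
   [:: Cup 0; Cross true 2; Cross true 1; Cross false 2; Cross true 3; Cross true 2; Cross true 3];
   [:: Cup 0; Cross false 1; Cross true 2; Cross true 1; Cross true 3; Cross true 2; Cross true 3];
   [:: Cup 1; Cross true 0; Cross true 2; Cross true 1; Cross true 3; Cross true 2; Cross true 3];
   [:: Cup 1; Cross true 2; Cross true 0; Cross true 1; Cross true 3; Cross true 2; Cross true 3];
   [:: Cup 1; Cross true 2; Cross true 0; Cross true 3; Cross true 1; Cross true 2; Cross true 3];
   [:: Cup 1; Cross true 2; Cross true 3; Cross true 0; Cross true 1; Cross true 2; Cross true 3]]).
have h2 : eqv [:: None; None; Some strand1; Some strand2; None]
    [:: Cross true 0; Cross true 1; Cross true 2; Cross true 3; Cross true 2; Cross true 1; Cap 0]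
    [:: Cross true 3; Cross true 2; Cap 1; Cross true 0; Cross true 1].
  by apply: (@chain_eqv _ _ [::
   [:: Cross true 0; Cross true 1; Cross true 3; Cross true 2; Cross true 3; Cross true 1; Cap 0];
   [:: Cross true 0; Cross true 1; Cross true 3; Cross true 2; Cross true 1; Cross true 3; Cap 0];
   [:: Cross true 0; Cross true 1; Cross true 3; Cross true 2; Cross true 1; Cap 0; Cross true 1];
   [:: Cross true 0; Cross true 3; Cross true 1; Cross true 2; Cross true 1; Cap 0; Cross true 1];
   [:: Cross true 0; Cross true 3; Cross true 2; Cross true 1; Cross true 2; Cap 0; Cross true 1];
   [:: Cross true 0; Cross true 3; Cross true 2; Cross true 1; Cap 0; Cross true 0; Cross true 1];
   [:: Cross true 0; Cross true 3; Cross true 2; Cross false 0; Cap 1; Cross true 0; Cross true 1];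
   [:: Cross true 0; Cross true 3; Cross false 0; Cross true 2; Cap 1; Cross true 0; Cross true 1];
   [:: Cross true 0; Cross false 0; Cross true 3; Cross true 2; Cap 1; Cross true 0; Cross true 1];
   [:: Cross true 3; Cross true 2; Cap 1; Cross true 0; Cross true 1]]).
apply: eqv_trans (eqv_catr [:: Cross true 2; Cross true 1; Cap 0] h1) _.
exact: (@eqv_catl [:: None; Some strand1; Some strand2] _
  [:: Cup 1; Cross true 2; Cross true 3] _ _ (erefl _) h2).
Qed.

Lemma run_pass_strands (q : nat) :
  run (pass_front q ++ offset 1 (pass_front q)) (nseq q None ++ empty_slice) =
  Some (empty_slice ++ nseq q None).
Proof.
have h1 := run_framer [:: Some strand2] (run_pass_front strand1 q).
rewrite -catA in h1.
exact: run_catS h1 (run_framel [:: Some strand1] (run_pass_front strand2 q)).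
Qed.

Lemma curve_y_slide (q : nat) :
  eqv (nseq q None ++ empty_slice)
    ((pass_front q ++ offset 1 (pass_front q)) ++ curve_y)
    (offset q curve_y ++ (pass_front q ++ offset 1 (pass_front q))).
Proof.
have hc : run curve_y empty_slice = Some empty_slice by [].
elim: q => [|q IH]; first by rewrite cats0 offset0.
have h1 := run_framer [:: Some strand2] (run_pass_front strand1 q); rewrite -catA in h1.
have h2 := run_pass_front strand2 q.
(* Regroups the crossings so that both strands pass the [q] right points before either passes the
   leftmost one. *)
have e : eqv (nseq q.+1 None ++ empty_slice)
    (pass_front q.+1 ++ offset 1 (pass_front q.+1))
    (offset 1 (pass_front q ++ offset 1 (pass_front q)) ++ [:: Cross true 0; Cross true 1]).
  have := @eqv_interchange [:: Cross true 0] _ [:: None; Some strand1]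
    [:: Some strand1; None] _ _ (erefl _) h2.
  move=> /(eqv_catl (run_framel [:: None] h1))/(eqv_catr [:: Cross true 1]).
  by rewrite !pass_frontS !offset_cat !offsetD -!catA.
apply: eqv_trans (eqv_catr _ e) _; rewrite -catA.
have h12 := run_pass_strands q.
have hy : eqv ([:: None] ++ empty_slice ++ nseq q None)
    ([:: Cross true 0; Cross true 1] ++ curve_y)
    (offset 1 curve_y ++ [:: Cross true 0; Cross true 1]).
  have hr : run ([:: Cross true 0; Cross true 1] ++ curve_y)
      [:: None; Some strand1; Some strand2] = Some [:: Some strand1; Some strand2; None].
    by [].
  exact: (eqv_framer (nseq q None) hr curve_y_cross).
apply: eqv_trans (eqv_catl (run_framel [:: None] h12) hy) _.
rewrite catA -offset_cat.
have := eqv_framel [:: None] (run_catS h12 (run_framer (nseq q None) hc)) IH.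
move=> /(eqv_catr [:: Cross true 0; Cross true 1])/eqv_trans; apply.
rewrite offset_cat offsetD -catA add1n.
apply/eqv_sym; apply: eqv_catl e.
have := run_framel (nseq q.+1 None) hc.
by rewrite size_nseq.
Qed.

(** Normal form of a word in front of the strands: [c] is its system of arcs, and the comb
    distributes their ends over [s]. *)
Definition lower_half (c : seq nat) (s : slice) : diagram := cups c ++ comb s.

Definition lower_half_ok (c : seq nat) (s : slice) : Prop :=
  filter isSome s = empty_slice /\
  run (cups c) [::] = Some (nseq (points s) None).

Lemma run_lower_half_cups (c : seq nat) (s : slice) :
  lower_half_ok c s -> run (cups c) empty_slice = Some (gather s).
Proof. by case=> es hc; rewrite /gather es; apply: (run_framer empty_slice hc). Qed.

Lemma run_lower_half (c : seq nat) (s : slice) :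
  lower_half_ok c s -> run (lower_half c s) empty_slice = Some s.
Proof. by move=> /run_lower_half_cups h; apply: run_catS h (run_comb s). Qed.

Lemma lower_half_eqv (c c' : seq nat) (s : slice) :
  eqv [::] (cups c) (cups c') -> lower_half_ok c s ->
  lower_half_ok c' s /\ eqv empty_slice (lower_half c s) (lower_half c' s).
Proof.
move=> h [es hc]; split; first by split=> //; rewrite -(eqv_run h).
exact/eqv_catr/(eqv_framer empty_slice hc h).
Qed.

Lemma lower_half_ok_rcons (c : seq nat) (i : nat) (s t : slice) :
  lower_half_ok (rcons c i) s -> filter isSome s = filter isSome t ->
  points s = (points t).+2 -> lower_half_ok c t.
Proof.
move=> [es /run_cups_rcons[m [em _ hc]]] est pst.
by split; [rewrite -est|rewrite hc; congr (Some (nseq _ _)); lia].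
Qed.

(** The legs of the last cup end side by side in the slice, so the cup may be born above the
    comb. *)
Lemma lower_half_cup (c : seq nat) (l r : slice) :
  lower_half_ok (rcons c (points l)) (l ++ [:: None, None & r]) ->
  lower_half_ok c (l ++ r) /\
  eqv empty_slice (lower_half (rcons c (points l)) (l ++ [:: None, None & r]))
    (lower_half c (l ++ r) ++ [:: Cup (size l)]).
Proof.
move=> h; have h' : lower_half_ok c (l ++ r).
  by apply: lower_half_ok_rcons h _ _; rewrite ?filter_cat // !points_cat /= !addnS.
split=> //; rewrite /lower_half cups_rcons -!catA.
exact: eqv_catl (run_lower_half_cups h') (eqv_sym (comb_cup l r)).
Qed.

Lemma lower_half_cross (n : strand) (c : seq nat) (l r : slice) :
  lower_half_ok c (l ++ [:: Some n, None & r]) ->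
  lower_half_ok c (l ++ [:: None, Some n & r]) /\
  eqv empty_slice (lower_half c (l ++ [:: Some n, None & r]))
    (lower_half c (l ++ [:: None, Some n & r]) ++ [:: Cross true (size l)]).
Proof.
move=> [es h]; have h' : lower_half_ok c (l ++ [:: None, Some n & r]).
  by split; [rewrite -es !filter_cat | rewrite h !points_cat].
split=> //; rewrite /lower_half -catA.
exact: eqv_catl (run_lower_half_cups h') (eqv_sym (comb_right n l r)).
Qed.

Lemma lower_half_cap (c : seq nat) (l r : slice) :
  lower_half_ok c (l ++ [:: None, None & r]) ->
  exists a c', lower_half_ok c' (l ++ r) /\
  eqv empty_slice (lower_half c (l ++ [:: None, None & r]) ++ [:: Cap (size l)])
    (loops a ++ lower_half c' (l ++ r)).
Proof.
move=> h; have [es hc] := h.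
have pE : points (l ++ [:: None, None & r]) = (points (l ++ r)).+2.
  by rewrite !points_cat /= !addnS.
have le_l : points l <= points (l ++ r) by rewrite points_cat leq_addr.
rewrite pE in hc; case: (cups_cap hc le_l) => a [c' h']; exists a, c'.
have hr : run (cups c ++ [:: Cap (points l)]) [::] = Some (nseq (points (l ++ r)) None).
  by apply: run_catS hc _; apply: act_cap_nseq.
split.
  split; first by rewrite -es !filter_cat.
  by rewrite -hr (eqv_run h') run_cat run_loops.
rewrite /lower_half -catA.
apply: eqv_trans (eqv_catl (run_lower_half_cups h) (comb_cap l r)) _.
rewrite -[Cap _ :: _]cat1s !catA; apply: eqv_catr.
exact: (eqv_framer empty_slice hr h').
Qed.

(** The arcs [c] pass in front of the strands, the arcs [d], being half-turned, behind them; both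
    have their ends on [s]. *)
Definition plat (c d : seq nat) (s : slice) : diagram :=
  lower_half c s ++ half_turn (lower_half d s).

Lemma plat_eqv (c d : seq nat) (s : slice) (H1 H2 : diagram) :
  lower_half_ok c s -> lower_half_ok d s ->
  eqv empty_slice (lower_half c s) H1 -> eqv empty_slice (lower_half d s) H2 ->
  eqv empty_slice (plat c d s) (H1 ++ half_turn H2).
Proof.
move=> /run_lower_half hc /run_lower_half hd h1 h2.
exact: (eqv_cat hc h1 (eqv_half_turn hd h2)).
Qed.

Lemma half_turn_plat (c d : seq nat) (s : slice) : half_turn (plat c d s) = plat d c s.
Proof. by rewrite /plat half_turn_cat half_turnK. Qed.

(** The arc of [c] is pushed through the middle slice and becomes a cap on the arcs [d]. This
    removes two endpoints and may split off circles, the [loops a]. *)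
Lemma good_plat_cup (c d c' : seq nat) (l r : slice) :
  lower_half_ok c (l ++ [:: None, None & r]) -> lower_half_ok d (l ++ [:: None, None & r]) ->
  eqv [::] (cups c) (cups (rcons c' (points l))) ->
  (forall c d, lower_half_ok c (l ++ r) -> lower_half_ok d (l ++ r) -> good (plat c d (l ++ r))) ->
  good (plat c d (l ++ [:: None, None & r])).
Proof.
move=> hc hd ec IH; have [hc' ec'] := lower_half_eqv ec hc.
have [hc'' ec''] := lower_half_cup hc'.
have [a [d' [hd' ed]]] := lower_half_cap hd.
apply: (@good_eqv _ (plat c' d' (l ++ r) ++ loops a)); last first.
  exact: good_cat (IH _ _ hc'' hd') (good_loops a).
apply: (eqv_trans (plat_eqv hc hd (eqv_trans ec' ec'') (eqv_refl _ _))).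
rewrite -[X in eqv _ X _]catA -[X in eqv _ _ X]catA; apply: eqv_catl (run_lower_half hc'') _.
have hl : all [in curves] (nseq a unknot) by rewrite all_nseq !inE orbT.
have -> : loops a = half_turn (loops a) by rewrite /loops half_turn_flatten // rev_nseq.
rewrite -half_turn_cat -[[:: Cup _]]/(half_turn [:: Cap (size l)]) -half_turn_cat.
apply: eqv_half_turn ed; apply: run_catS (run_lower_half hd) _.
by rewrite run1; apply/actP/acts_cap.
Qed.

(** [A] is the arc on top of both halves. Glued to its half turn it is a ring, which leaves at the
    bottom as the curve [w]. *)
Lemma good_plat_ring (c d c' d' : seq nat) (s s' : slice) (A w : diagram) :
  lower_half_ok c s -> lower_half_ok d s -> lower_half_ok c' s' -> lower_half_ok d' s' ->
  eqv empty_slice (lower_half c s) (lower_half c' s' ++ A) ->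
  eqv empty_slice (lower_half d s) (lower_half d' s' ++ A) ->
  w \in curves ->
  eqv empty_slice (lower_half c' s' ++ A ++ half_turn A) (w ++ lower_half c' s') ->
  good (plat c' d' s') -> good (plat c d s).
Proof.
move=> hc hd hc' hd' ec ed hw h g.
apply: (@good_eqv _ (w ++ plat c' d' s')); last first.
  exact: good_cat (good_curve hw) g.
apply: (eqv_trans (plat_eqv hc hd ec ed)).
by have := eqv_catr (half_turn (lower_half d' s')) h; rewrite /plat half_turn_cat -!catA.
Qed.

(** ** Slices of a pair of strands *)

Definition slice3 (a b e : nat) : slice :=
  nseq a None ++ Some strand1 :: nseq b None ++ Some strand2 :: nseq e None.

Lemma slice3P (s : slice) :
  filter isSome s = empty_slice -> exists a b e, s = slice3 a b e.
Proof.
have h (x : slice) (y : strand) t : filter isSome x = Some y :: t ->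
    exists a x', x = nseq a None ++ Some y :: x' /\ filter isSome x' = t.
  elim: x => // -[z|] x IH /=; first by case=> -> <-; exists 0, x.
  by case/IH=> a [x' [-> <-]]; exists a.+1, x'.
case/h=> a [x [-> /h[b [x' [-> h']]]]]; exists a, b, (size x').
have -> : x' = nseq (size x') None; last by rewrite size_nseq.
by elim: x' h' => //= -[z|] x' IH // /IH{1}->.
Qed.

Lemma points_nseq (a : nat) : points (nseq a None) = a.
Proof. by rewrite /points count_nseq mul1n. Qed.

Lemma points_some (n : strand) (s : slice) : points (Some n :: s) = points s.
Proof. by []. Qed.

Lemma points_none (s : slice) : points (None :: s) = (points s).+1.
Proof. by []. Qed.

Definition pointsE := (points_cat, points_nseq, points_some, points_none).

Lemma points_slice3 (a b e : nat) : points (slice3 a b e) = a + b + e.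
Proof.
by rewrite /slice3 !pointsE !addnA.
Qed.

Lemma slice3_pair (a b e i : nat) :
  i.+2 <= a + b + e -> i.+1 != a -> i.+1 != a + b ->
  exists l r, slice3 a b e = l ++ [:: None, None & r] /\ points l = i.
Proof.
move=> le_i ne_a ne_ab; rewrite /slice3.
have split2 j m : j.+2 <= m -> nseq m None =
    nseq j None ++ [:: None, None & nseq (m - j.+2) (None : point)].
  by move=> le_j; rewrite -[[:: _, _ & _]]/(nseq (m - j.+2).+2 None) -nseqD; congr nseq; lia.
have [lt_ia|le_ai] := ltnP i a.
  rewrite (split2 i a); last by lia.
  exists (nseq i None); eexists; rewrite -catA; split; first by [].
  exact: points_nseq.
have [lt_iab|le_abi] := ltnP i (a + b).
  rewrite (split2 (i - a) b); last by lia.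
  exists (nseq a None ++ Some strand1 :: nseq (i - a) None); eexists.
  rewrite -?catA /= -?catA; split; first by [].
  by rewrite !pointsE; lia.
rewrite (split2 (i - (a + b)) e); last by lia.
exists (nseq a None ++ Some strand1 :: nseq b None ++
  Some strand2 :: nseq (i - (a + b)) None); eexists.
rewrite -?catA /= -?catA; split; first by [].
by rewrite !pointsE; lia.
Qed.

(** Innermost arcs are those that can be born last after an isotopy of the cups. *)
Definition last_cup (c : seq nat) (i : nat) : Prop :=
  exists c', eqv [::] (cups c) (cups (rcons c' i)).

Lemma last_cup_bound (c : seq nat) (m i : nat) :
  run (cups c) [::] = Some (nseq m None) -> last_cup c i -> i.+2 <= m.
Proof. by move=> hc [c' h]; move: hc; rewrite (eqv_run h) => /run_cups_rcons[m' [-> ? _]]. Qed.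

(** The cuts stand for the numbers of skein points to the left of the two strands. By [cups_cut],
    each cut is avoided by some innermost cup or is the centre of a rainbow; a cup that avoids one
    cut but not both surrounds the other. *)
Lemma cups_two_cuts (c : seq nat) (m a b : nat) :
  run (cups c) [::] = Some (nseq m None) -> 0 < m ->
  (exists2 i, last_cup c i & (i.+1 != a) && (i.+1 != b)) \/
  let alpha := exists2 i, last_cup c i & i.+1 = a in
  let beta := exists2 i, last_cup c i & i.+1 = b in
  (beta \/ alpha /\ a.*2 = m) /\ (alpha \/ beta /\ b.*2 = m).
Proof.
move=> hc m_gt0; have em := run_cups_size hc.
have c_gt0 : 0 < size c by move: m_gt0; rewrite em double_gt0.
have cut w : (exists2 i, last_cup c i & i.+1 != w) \/
    (exists2 i, last_cup c i & i.+1 = w) /\ w.*2 = m.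
  have [c' [i [h hi]]] := cups_cut w hc c_gt0.
  by case: hi => [ne|[e1 e2]]; [left|right; split; last by rewrite em e2];
    exists i => //; exists c'.
case: (cut a) => [[i ha ne_a]|[[i ha ea] am]].
  have [eb|ne_b] := eqVneq i.+1 b; last by left; exists i; rewrite // ne_a.
  case: (cut b) => [[j hb ne_b]|[[j hb eb'] bm]].
    have [ea|ne_a'] := eqVneq j.+1 a; last by left; exists j; rewrite // ne_a'.
    by right; split; [left; exists i|left; exists j].
  by right; split; [left; exists i|right; split=> //; exists j].
case: (cut b) => [[j hb ne_b]|[[j hb eb] bm]].
  have [ea'|ne_a] := eqVneq j.+1 a; last by left; exists j; rewrite // ne_a.
  by right; split; [right; split=> //; exists i|left; exists j].
by right; split; [left; exists j|left; exists i].
Qed.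

(** The last cups of [c] and [d] are arcs in front of and behind strand [n], and
    close up to a ring around it. *)
Lemma good_plat_strand (n : strand) (c d : seq nat) (l r : slice) :
  Some n \notin l ->
  lower_half_ok c (l ++ [:: None, Some n, None & r]) ->
  lower_half_ok d (l ++ [:: None, Some n, None & r]) ->
  last_cup c (points l) -> last_cup d (points l) ->
  (forall c d, lower_half_ok c (l ++ Some n :: r) -> lower_half_ok d (l ++ Some n :: r) ->
     good (plat c d (l ++ Some n :: r))) ->
  good (plat c d (l ++ [:: None, Some n, None & r])).
Proof.
move=> hl hc hd [c' ec] [d' ed] IH.
pose A := [:: Cup (size l); Cross true (size l).+1].
have arc c0 c1 : lower_half_ok c0 (l ++ [:: None, Some n, None & r]) ->
    eqv [::] (cups c0) (cups (rcons c1 (points l))) ->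
    lower_half_ok c1 (l ++ Some n :: r) /\
    eqv empty_slice (lower_half c0 (l ++ [:: None, Some n, None & r]))
      (lower_half c1 (l ++ Some n :: r) ++ A).
  move=> hc0 h; have [hc1 ec1] := lower_half_eqv h hc0.
  rewrite -cat_rcons in hc1 ec1; have [hc2 ec2] := lower_half_cross hc1.
  rewrite cat_rcons in hc2 ec2; have [hc3 ec3] := lower_half_cup hc2; split=> //.
  rewrite -cat_rcons; apply: (eqv_trans ec1); apply: (eqv_trans ec2).
  have := eqv_catr [:: Cross true (size (rcons l None))] ec3.
  by rewrite -catA /= size_rcons.
have [hc' ec'] := arc _ _ hc ec; have [hd' ed'] := arc _ _ hd ed.
apply: (good_plat_ring (w := offset (index (Some n) empty_slice) curve_x) hc hd hc' hd' ec' ed').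
(* The ring is [curve_x] for strand 1 and, shifted by one, [curve_z] for strand 2. *)
- by case: (n).
- have -> : A ++ half_turn A = offset (index (Some n) (l ++ Some n :: r)) curve_x.
    by rewrite index_strand // /offset /= /offset_event /= addn0 addn1.
  by apply: ring_slide_word (run_lower_half hc'); case: (n).
- exact: IH.
Qed.

Lemma lower_half_arc2 (c0 c : seq nat) (l r : slice) :
  let s := l ++ [:: None, Some strand1, Some strand2, None & r] in
  lower_half_ok c0 s -> eqv [::] (cups c0) (cups (rcons c (points l))) ->
  lower_half_ok c (l ++ empty_slice ++ r) /\
  eqv empty_slice (lower_half c0 s) (lower_half c (l ++ empty_slice ++ r) ++
    [:: Cup (size l); Cross true (size l).+1; Cross true (size l).+2]).
Proof.
move=> s hc0 h; have [hc1 ec1] := lower_half_eqv h hc0.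
have sE : s = rcons (rcons l None) (Some strand1) ++ [:: Some strand2, None & r].
  by rewrite !cat_rcons.
rewrite sE in hc1 ec1 *; have [hc2 ec2] := lower_half_cross hc1.
rewrite cat_rcons in hc2 ec2; have [hc3 ec3] := lower_half_cross hc2.
rewrite cat_rcons in hc3 ec3; have [hc4 ec4] := lower_half_cup hc3; split=> //.
apply: (eqv_trans ec1); apply: (eqv_trans ec2).
have := eqv_catr [:: Cross true (size l).+1; Cross true (size l).+2] ec4.
rewrite -catA; apply: eqv_trans.
have := eqv_catr [:: Cross true (size l).+2] ec3.
by rewrite -catA !size_rcons.
Qed.

(** The last arcs close up to a ring around both strands. It slides below the comb by
    [curve_y_slide], as no skein point lies between the strands, and below the cups because these
    are all on its left. *)
Lemma good_plat_strands (c d : seq nat) (p q : nat) :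
  let s := nseq p None ++ [:: None, Some strand1, Some strand2, None & nseq q None] in
  lower_half_ok c s -> lower_half_ok d s -> last_cup c p -> last_cup d p ->
  (forall c d, lower_half_ok c (slice3 p 0 q) -> lower_half_ok d (slice3 p 0 q) ->
     good (plat c d (slice3 p 0 q))) ->
  good (plat c d s).
Proof.
move=> s hc hd [c' ec] [d' ed] IH.
pose A := [:: Cup p; Cross true p.+1; Cross true p.+2].
have arc c0 c1 : lower_half_ok c0 s -> eqv [::] (cups c0) (cups (rcons c1 p)) ->
    lower_half_ok c1 (slice3 p 0 q) /\
    eqv empty_slice (lower_half c0 s) (lower_half c1 (slice3 p 0 q) ++ A).
  move=> hc0; rewrite -{1}(points_nseq p) => /(lower_half_arc2 hc0).
  by rewrite size_nseq.
have [hc' ec'] := arc _ _ hc ec; have [hd' ed'] := arc _ _ hd ed.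
apply: (good_plat_ring (w := curve_y) hc hd hc' hd' ec' ed').
- by [].
- have -> : A ++ half_turn A = offset p curve_y.
    by rewrite /offset /= /offset_event /= addn0 addn1 addn2.
  (* The [p] left points are in place already; each strand passes behind the [q] others. *)
  have cE : comb (slice3 p 0 q) = offset p (pass_front q ++ offset 1 (pass_front q)).
    have cp (l : nat) (x : slice) : comb (nseq l None ++ x) = offset l (comb x).
      by elim: l => [|l IHl]; rewrite ?offset0 //= IHl offsetD.
    by rewrite /slice3 cp /= -{3}[nseq q None]cats0 cp /= points_nseq cats0.
  have hg := run_lower_half_cups hc'.
  have gE : gather (slice3 p 0 q) = nseq p None ++ (nseq q None ++ empty_slice).
    by case: hc' => es _; rewrite /gather es points_slice3 addn0 nseqD -catA.
  have hcomb : run ((pass_front q ++ offset 1 (pass_front q)) ++ curve_y)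
     (nseq q None ++ empty_slice) = Some (empty_slice ++ nseq q None).
    exact: run_catS (run_pass_strands q) _.
  rewrite /lower_half -catA cE.
  have := eqv_framel (nseq p None) hcomb (curve_y_slide q).
  rewrite size_nseq -gE (offset_cat p (_ ++ _)) (offset_cat p (offset q _)) offsetD.
  move=> /(eqv_catl hg)/eqv_trans; apply.
  rewrite !catA; apply: eqv_catr.
  have [es hcu] := hc'.
  have := @eqv_interchange (cups c') curve_y [::] _ empty_slice empty_slice hcu (erefl _).
  by rewrite size_nseq points_slice3 addn0 offset0.
- exact: IH.
Qed.

Lemma good_plat (c d : seq nat) (s : slice) :
  lower_half_ok c s -> lower_half_ok d s -> good (plat c d s).
Proof.
have [k] := ubnP (points s); elim: k c d s => // k IH c d s lt_s hc hd.
have {}IH s' : points s' < points s ->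
    forall c d, lower_half_ok c s' -> lower_half_ok d s' -> good (plat c d s').
  by move=> lt_s' c0 d0; apply: IH; lia.
have [es hrc] := hc; have [_ hrd] := hd.
case: (slice3P es) => a [b [e es3]].
move: lt_s IH hc hd hrc hrd; rewrite es3 points_slice3 => {es es3 s} _ IH hc hd hrc hrd.
have [m0|m_gt0] := posnP (a + b + e).
  exists [::] => //.
  have [ea eb ee] : [/\ a = 0, b = 0 & e = 0] by split; lia.
  have nil x : run (cups x) [::] = Some (nseq (a + b + e) None) -> x = [::].
    move/run_cups_size; rewrite m0 => /esym/eqP.
    by rewrite double_eq0 => /nilP.
  by rewrite (nil c) // (nil d) // ea eb ee.
(* An innermost arc avoiding both cuts has no strand between its ends. The statement is general in
   [c0] and [d0] so that it also serves for [d], through the half turn. *)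
have reduce c0 d0 i : lower_half_ok c0 (slice3 a b e) -> lower_half_ok d0 (slice3 a b e) ->
    last_cup c0 i -> i.+1 != a -> i.+1 != a + b -> good (plat c0 d0 (slice3 a b e)).
  move=> hc0 hd0 hi ne1 ne2; have [_ hrc0] := hc0.
  have := last_cup_bound hrc0 hi; rewrite points_slice3 => le_i.
  case: (slice3_pair le_i ne1 ne2) => l [r [es pl]].
  rewrite es in hc0 hd0 *; case: hi => c1; rewrite -pl => h.
  apply: (good_plat_cup hc0 hd0 h) => c2 d2; apply: IH.
  by rewrite -points_slice3 es !points_cat /= !addnS ltnS leqnSn.
case: (cups_two_cuts a (a + b) hrc m_gt0) => [[i hi /andP[ne1 ne2]]|hc2].
  exact: reduce hc hd hi ne1 ne2.
case: (cups_two_cuts a (a + b) hrd m_gt0) => [[i hi /andP[ne1 ne2]]|hd2].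
  by rewrite -half_turn_plat; apply/good_half_turn/(reduce d c i).
(* If [b] is 0 the two cuts coincide, and the innermost arcs found on both sides surround both
   strands. *)
have [b0|b_gt0] := posnP b.
  have [i hi ea] : exists2 i, last_cup c i & i.+1 = a.
    by case: hc2 => -[[i hi ea]|[[i hi ea] _]] _; exists i; rewrite // ea b0 addn0.
  have [j hj ej] : exists2 i, last_cup d i & i.+1 = a.
    by case: hd2 => -[[j hj ej]|[[j hj ej] _]] _; exists j; rewrite // ej b0 addn0.
  have eij : j = i by lia.
  rewrite eij in hj; have le_e := last_cup_bound hrc hi; rewrite -ea b0 in le_e.
  case: e le_e {m_gt0 reduce hrc hrd hc2 hd2} hc hd IH => [|e] le_e hc hd IH; first by lia.
  have es : slice3 a b e.+1 =
      nseq i None ++ [:: None, Some strand1, Some strand2, None & nseq e None].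
    by rewrite /slice3 -ea b0 -[i.+1]addn1 nseqD -catA.
  rewrite es in hc hd *.
  by apply: (@good_plat_strands c d i e hc hd hi hj); apply: IH; rewrite points_slice3; lia.
case: b b_gt0 {m_gt0} hc2 hd2 reduce hrc hrd hc hd IH => // b _ hc2 hd2 _ hrc hrd hc hd IH.
have alpha : (exists2 i, last_cup c i & i.+1 = a) ->
    (exists2 i, last_cup d i & i.+1 = a) -> good (plat c d (slice3 a b.+1 e)).
  move=> [i hi ea] [j hj ej]; have eij : j = i by lia.
  rewrite eij in hj.
  have es : slice3 a b.+1 e =
      nseq i None ++ [:: None, Some strand1, None & nseq b None ++ Some strand2 :: nseq e None].
    by rewrite /slice3 -ea -[i.+1]addn1 nseqD -catA.
  rewrite es in hc hd *; apply: good_plat_strand hc hd _ _ _; rewrite ?points_nseq //.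
    by rewrite mem_nseq andbF.
  by apply: IH; rewrite !pointsE; lia.
have beta : (exists2 i, last_cup c i & i.+1 = a + b.+1) ->
    (exists2 i, last_cup d i & i.+1 = a + b.+1) -> good (plat c d (slice3 a b.+1 e)).
  rewrite addnS => -[i hi [ei]] [j hj [ej]]; subst i j.
  have le_e := last_cup_bound hrc hi.
  case: e le_e {hc2 hd2 alpha hrc hrd} hc hd IH => [|e] le_e hc hd IH; first by lia.
  have es : slice3 a b.+1 e.+1 = (nseq a None ++ Some strand1 :: nseq b None) ++
      [:: None, Some strand2, None & nseq e None].
    by rewrite /slice3 -catA -[b.+1]addn1 nseqD /= -catA.
  rewrite es in hc hd *; apply: good_plat_strand hc hd _ _ _; rewrite ?pointsE //.
    by rewrite mem_cat inE !mem_nseq !andbF.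
  by apply: IH; rewrite !pointsE; lia.
(* Without a common strand, one system is a rainbow at [a] and the other at [a + b.+1]; both cuts
   would then halve the endpoints, which [lia] refutes. *)
case: hc2 => -[bc|[ac a2]] [ac'|[bc' ab2]]; case: hd2 => -[bd|[ad a2']] [ad'|[bd' ab2']];
  by [apply: alpha | apply: beta | lia].
Qed.

(** * Front words followed by back words, as plats *)

Definition flip_crossing (c : strand * bool) : strand * bool := (c.1, ~~ c.2).

Lemma clean_acts_upside_down (e : event) (s t : slice) c :
  clean_acts e s t c -> clean_acts (upside_down e) t s (omap flip_crossing c).
Proof.
case=> [l r|l r|o n l r|o n l r] /=.
- exact: clean_cap.
- exact: clean_cup.
- by rewrite -{1}[o]negbK; apply: clean_left.
- exact: clean_right.
Qed.

Lemma clean1 (s : slice) (e : event) : clean s [:: e] = ~~ self_crossing s e.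
Proof. by rewrite /= andbT. Qed.

Lemma crossings1 (s : slice) (e : event) :
  crossings s [:: e] = seq_of_opt (crossing_of s e).
Proof. by rewrite /= cats0. Qed.

Lemma crossings_half_turn (D : diagram) (s t : slice) :
  run D s = Some t -> clean s D ->
  clean t (half_turn D) /\ crossings t (half_turn D) = rev (map flip_crossing (crossings s D)).
Proof.
elim: D s => [|e D IH] s; first by case=> <-.
move=> /run_consP[u hu hD]; rewrite (clean_cons _ hu) (crossings_cons _ hu).
case/andP=> /(clean_actsP hu)/clean_acts_upside_down/clean_actsE[ce xe] /(IH _ hD)[cD xD].
rewrite -cat1s half_turn_cat (clean_cat _ (run_half_turn hD)) (crossings_cat _ (run_half_turn hD)).
rewrite cD xD clean1 crossings1 ce xe map_cat rev_cat; split=> //.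
by congr (_ ++ _); case: crossing_of.
Qed.

Lemma front_lower_half (D : diagram) (s : slice) :
  run D empty_slice = Some s -> clean empty_slice D ->
  all snd (crossings empty_slice D) ->
  exists a c, lower_half_ok c s /\ eqv empty_slice D (loops a ++ lower_half c s).
Proof.
move=> hD cD oD; case: (front_word hD cD oD) => f [pf hf h].
case: (plain_word pf hf) => a [c hc]; exists a, c.
have hrc := hf; rewrite (eqv_run hc) run_cat run_loops /= in hrc.
split; first by split=> //; rewrite -(run_strands hD).
apply: (eqv_trans h); rewrite /lower_half catA; apply: eqv_catr.
exact: (eqv_framer empty_slice hf hc).
Qed.

Lemma half_turn_loops (a : nat) : half_turn (loops a) = loops a.
Proof. by rewrite /loops half_turn_flatten ?rev_nseq // all_nseq !inE orbT. Qed.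

Lemma good_front_back (O U : diagram) (s : slice) :
  run O empty_slice = Some s -> clean empty_slice O ->
  all snd (crossings empty_slice O) ->
  run U s = Some empty_slice -> clean s U ->
  all (fun c => ~~ c.2) (crossings s U) ->
  good (O ++ U).
Proof.
move=> hO cO oO hU cU oU.
case: (front_lower_half hO cO oO) => a [c [hc ec]].
have [cU' xU'] := crossings_half_turn hU cU.
have oU' : all snd (crossings empty_slice (half_turn U)) by rewrite xU' all_rev all_map.
case: (front_lower_half (run_half_turn hU) cU' oU') => b [d [hd ed]].
have := eqv_cat hO ec (eqv_half_turn (run_half_turn hU) ed).
rewrite half_turnK half_turn_cat half_turn_loops -catA => /good_eqv; apply.
apply: good_cat (good_loops a) _; rewrite catA.
exact: good_cat (good_plat hc hd) (good_loops b).
Qed.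

(** * Ordering the curves into parallel copies *)

Lemma curve_commute (c W : diagram) :
  c \in [:: curve_x; curve_z; unknot] -> run W empty_slice = Some empty_slice ->
  eqv empty_slice (W ++ c) (c ++ W).
Proof.
rewrite !inE => /or3P[] /eqP-> hW.
- exact: (@ring_slide_word strand1) hW.
- exact: (@ring_slide_word strand2) hW.
- exact: unknot_slide hW.
Qed.

(** Only [curve_x], [curve_z] and [unknot] commute with every closed word here; moving these past
    the others is enough, the copies of [curve_y] keeping their order. *)
Lemma good_parallel (D : diagram) : good D ->
  exists i j k u, eqv empty_slice D (parallel_copies i j k u).
Proof.
pose pow c n : diagram := flatten (nseq n c).
have powS c n : pow c n.+1 = c ++ pow c n by [].
have par i j k u : parallel_copies i j k u =
    pow curve_x i ++ pow curve_y j ++ pow curve_z k ++ pow unknot u.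
  by rewrite /parallel_copies !flatten_cat.
have run_pow c n : c \in curves -> run (pow c n) empty_slice = Some empty_slice.
  by move=> hc; apply: run_flatten; rewrite all_nseq /= hc orbT.
have hx i : run (pow curve_x i) empty_slice = Some empty_slice by apply: run_pow.
have hy j : run (pow curve_y j) empty_slice = Some empty_slice by apply: run_pow.
have hz k : run (pow curve_z k) empty_slice = Some empty_slice by apply: run_pow.
case=> cs hcs h.
suff [i [j [k [u hp]]]] : exists i j k u, eqv empty_slice (flatten cs) (parallel_copies i j k u).
  by exists i, j, k, u; apply: eqv_trans h hp.
elim: cs hcs {h D} => [|c cs IH] /=; first by exists 0, 0, 0, 0.
case/andP=> hc /IH[i [j [k [u hp]]]].
have {}hp := eqv_catl (run_curve hc) hp.
move: hc; rewrite !inE => /or4P[] /eqP ec; subst c.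
- by exists i.+1, j, k, u.
- exists i, j.+1, k, u; apply: (eqv_trans hp); rewrite !par powS !catA.
  do 3!apply: eqv_catr; elim: i {hp} => [|i IHi]; first by rewrite cats0.
  rewrite powS -!catA catA.
  apply: eqv_trans (eqv_catr _ (@curve_commute curve_x curve_y _ _)) _ => //.
  by rewrite -catA; apply: eqv_catl IHi.
- exists i, j, k.+1, u; apply: (eqv_trans hp); rewrite !par powS !catA.
  do 2!apply: eqv_catr; rewrite -catA -[X in eqv _ _ X]catA.
  rewrite [X in eqv _ X _]catA [X in eqv _ _ X]catA; apply: eqv_sym.
  rewrite -[X in eqv _ _ X]catA; apply: curve_commute => //.
  exact: run_catS (hx i) (hy j).
- exists i, j, k, u.+1; apply: (eqv_trans hp); rewrite !par powS !catA.
  apply: eqv_catr; apply: eqv_sym.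
  rewrite -2![X in eqv _ _ X]catA [X in eqv _ _ (_ ++ X)]catA; apply: curve_commute => //.
  exact: run_catS (run_catS (hx i) (hy j)) (hz k).
Qed.

(** * Fingers pulled along a strand *)

(** The tip of a finger in front of the strand at position [p], with one leg on each side. [fork],
    [widen] and [finger_cap] are the pieces from which [switch] is built. *)
Definition fork (p : nat) : diagram := [:: Cup p; Cross true p.+1].

Definition wide (n : strand) (s : slice) : slice :=
  let p := index (Some n) s in
  take p s ++ [:: None, Some n, None & drop p.+1 s].

Definition widen_event (n : strand) (s : slice) (e : event) : event :=
  if pos e <= index (Some n) s then e else at_pos e (pos e).+2.

Fixpoint widen (n : strand) (s : slice) (D : diagram) : diagram :=
  if D is e :: D' then widen_event n s e :: widen n (odflt s (act e s)) D'
  else [::].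

Lemma drop_size_cat1 (T : Type) (l r : seq T) (x : T) :
  drop (size l).+1 (l ++ x :: r) = r.
Proof. by rewrite -cat_rcons drop_size_cat // size_rcons. Qed.

Lemma wideE (n : strand) (l r : slice) : Some n \notin l ->
  wide n (l ++ Some n :: r) = l ++ [:: None, Some n, None & r].
Proof.
by move=> hl; rewrite /wide index_strand // take_size_cat // drop_size_cat1.
Qed.

Lemma run_fork (n : strand) (s : slice) : Some n \in s ->
  run (fork (index (Some n) s)) s = Some (wide n s).
Proof.
case/split_strand=> l [r [-> hl]]; rewrite wideE // index_strand //.
have := run_frame l r (erefl : run (fork 0) [:: Some n] = Some [:: None; Some n; None]).
by rewrite /offset /= /offset_event /= addn0 addn1.
Qed.

Lemma clean_acts_frame (e : event) (l s t r : slice) c :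
  clean_acts e s t c -> clean_acts (offset_event (size l) e) (l ++ s ++ r) (l ++ t ++ r) c.
Proof.
case=> [l' r'|l' r'|o n l' r'|o n l' r']; rewrite -!catA /= !(catA l) /offset_event /= -size_cat.
- exact: clean_cup.
- exact: clean_cap.
- exact: clean_right.
- exact: clean_left.
Qed.

Lemma strand_stays (n : strand) (e : event) (s t : slice) :
  act e s = Some t -> Some n \in s -> Some n \in t.
Proof. by move=> h; apply: contraLR; apply: act_notin (act_upside_down h). Qed.

Lemma widen_eventP (n : strand) (e : event) (s t : slice) (c : option (strand * bool)) :
  clean_acts e s t c -> Some n \in s -> omap fst c != Some n ->
  clean_acts (widen_event n s e) (wide n s) (wide n t) c /\
  eqv s (e :: fork (index (Some n) t)) (fork (index (Some n) s) ++ [:: widen_event n s e]).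
Proof.
move=> hc hs ne; have he := clean_acts_act hc.
case/split_strand: hs he hc => l [r [-> hl]] he hc.
have [ce xe] := clean_actsE hc.
have rf : run (fork 0) [:: Some n] = Some [:: None; Some n; None] by [].
have sl : offset (size l) (fork 0) = fork (size l).
  by rewrite /offset /= /offset_event /= addn0 addn1.
rewrite wideE // index_strand //.
case/act_strand_cases: (he).
- case=> l2 hel et; have hl2 := act_notin hel hl.
  have le_e : pos e <= size l.
    by case: (proj1 (actP _ _ _) hel) => [l' r'|l' r'|b l' x y r' _] /=; rewrite ?size_cat; lia.
  rewrite et in hc *; rewrite /widen_event index_strand // le_e index_strand // wideE //.
  have cl : clean_acts e l l2 c.
    have cl' : ~~ self_crossing l e.
      apply: contra ce; case: (proj1 (actP _ _ _) hel) => // b l' x y r' _.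
      by rewrite /= -catA !drop_size_cat //= !take0.
    have := clean_actsP hel cl'; congr clean_acts; rewrite -xe.
    case: (proj1 (actP _ _ _) hel) => // b l' x y r' _.
    by rewrite /= -catA !drop_size_cat //=; case: (x) (y) => [?|] [?|].
  split.
    by have := clean_acts_frame [::] [:: None, Some n, None & r] cl; rewrite offset_event0.
  have := @eqv_interchange [:: e] (fork 0) l l2 (Some n :: r) [:: None, Some n, None & r] hel.
  rewrite -!/(offset _ _) => /(_ (run_framer r rf)).
  by rewrite /offset /= /offset_event /= !addn0 !addn1.
- case=> f [r2 [ef hf et]]; rewrite et ef in hc ce xe *.
  rewrite /widen_event index_strand // index_strand // wideE //.
  have -> : (pos (offset_event (size l).+1 f) <= size l) = false.
    by case: (f) => * /=; lia.
  have -> : at_pos (offset_event (size l).+1 f) (pos (offset_event (size l).+1 f)).+2 =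
      offset_event (size (l ++ [:: None; Some n; None])) f.
    by rewrite size_cat /=; case: (f) => * /=; congr (_ _); lia.
  have cf : clean_acts f r r2 c.
    have cf' : ~~ self_crossing r f.
      apply: contra ce; case: (proj1 (actP _ _ _) hf) => // b l' x y r' _.
      rewrite /= drop_size_cat // -cat_rcons -(size_rcons l (Some n)) -size_cat catA.
      by rewrite drop_size_cat.
    have := clean_actsP hf cf'; congr clean_acts; rewrite -xe.
    case: (proj1 (actP _ _ _) hf) => // b l' x y r' _.
    rewrite /= drop_size_cat // -cat_rcons -(size_rcons l (Some n)) -size_cat catA.
    by rewrite drop_size_cat.
  split.
    have := clean_acts_frame (l ++ [:: None; Some n; None]) [::] cf.
    by rewrite !cats0 -!catA.
  have h := @eqv_interchange (fork 0) [:: f] [:: Some n] _ r r2 rf hf.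
  have hrun := run_catS (run_framer r rf) (@run_framel [:: f] [:: None; Some n; None] _ _ hf).
  have := eqv_framel l hrun h.
  rewrite !offset_cat !offsetD sl -size_cat size_cat => /eqv_sym.
  by rewrite /= addn1.
- case=> b [l1 [el eb et]]; move: xe ne; rewrite eb el cat_rcons /= drop_size_cat // => <-.
  by rewrite /= eqxx.
- case=> b [r1 [er eb et]]; move: xe ne; rewrite eb er /= drop_size_cat // => <-.
  by rewrite /= eqxx.
Qed.

Definition avoids (n : strand) (C : seq (strand * bool)) : bool :=
  all (fun c => c.1 != n) C.

(** The first three conclusions describe the room made by [switch] for the legs of the finger; the
    last is the isotopy that pulls the finger down, applied to sorted terms only. *)
Lemma widenP (n : strand) (D : diagram) (s t : slice) :
  run D s = Some t -> clean s D -> Some n \in s -> avoids n (crossings s D) ->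
  [/\ run (widen n s D) (wide n s) = Some (wide n t),
      clean (wide n s) (widen n s D),
      crossings (wide n s) (widen n s D) = crossings s D
    & eqv s (D ++ fork (index (Some n) t)) (fork (index (Some n) s) ++ widen n s D)].
Proof.
elim: D s => [|e D IH] s.
  by case=> <- _ _ _; split; rewrite ?cats0.
move=> /run_consP[u hu hD]; rewrite (clean_cons _ hu) (crossings_cons _ hu).
move=> /andP[ce cD] hs; rewrite /avoids all_cat => /andP[ae aD].
have hc := clean_actsP hu ce.
have ne : omap fst (crossing_of s e) != Some n.
  by case: crossing_of ae => //= c /andP[].
have [hw hf] := widen_eventP hc hs ne.
have [r1 c1 x1 e1] := IH u hD cD (strand_stays hu hs) aD.
have hw' := clean_acts_act hw; have [cw xw] := clean_actsE hw.
have -> : widen n s (e :: D) = widen_event n s e :: widen n u D by rewrite /= hu.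
split.
- by rewrite run_cons hw'.
- by rewrite (clean_cons _ hw') cw.
- by rewrite (crossings_cons _ hw') xw x1.
- apply: eqv_trans (@eqv_catl s u [:: e] _ _ hu e1) _.
  rewrite catA; apply: eqv_trans (eqv_catr _ hf) _.
  by rewrite -catA.
Qed.

Lemma strand_unique (n : strand) (l r : slice) :
  filter isSome (l ++ Some n :: r) = empty_slice -> Some n \notin l.
Proof.
move=> es; have : uniq (filter isSome (l ++ Some n :: r)) by rewrite es.
rewrite filter_cat cat_uniq /= negb_or => /and3P[_ /andP[h _] _].
by move: h; rewrite mem_filter.
Qed.

Lemma strand_in (n : strand) (s : slice) : filter isSome s = empty_slice -> Some n \in s.
Proof.
move=> es; suff : Some n \in filter isSome s by rewrite mem_filter.
by rewrite es; case: n.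
Qed.

Definition finger_cap (n : strand) (s : slice) (e : event) : event :=
  let p := index (Some n) s in Cap (if pos e != p then p.-1 else p.+2).

(** The cap joins one leg of the finger to the skein point that was about to cross; a snake move
    straightens it, leaving the overcrossing. *)
Lemma finger_capP (n : strand) (e : event) (s t : slice) :
  filter isSome s = empty_slice -> clean_acts e s t (Some (n, true)) ->
  act (finger_cap n s e) (wide n s) = Some t /\
  eqv s (fork (index (Some n) s) ++ [:: finger_cap n s e]) [:: e].
Proof.
move=> es; move Ec: (Some (n, true)) => c h.
case: h Ec es => [//|//|o n' l r [<- <-]|o n' l r [<- <-]].
- rewrite -[l ++ [:: None, _ & _]]cat_rcons => es; have hl := strand_unique es.
  have -> : finger_cap n (rcons l None ++ Some n :: r) (Cross true (size l)) = Cap (size l).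
    by rewrite /finger_cap index_strand // size_rcons /= neq_ltn ltnSn.
  rewrite wideE // index_strand // size_rcons !cat_rcons.
  split; first by apply/actP/acts_cap.
  have hr : run [:: Cup 1; Cross true 2; Cap 0] [:: None; Some n] = Some [:: Some n; None] by [].
  have := eqv_frame l r hr (@chain_eqv _ _
    [:: [:: Cup 1; Cap 0; Cross true 0]; [:: Cross true 0]] _).
  rewrite /offset /= /offset_event /= !addn0 addn1 addn2; apply.
  by case: (n).
- move=> es; have hl := strand_unique es.
  have -> : finger_cap n (l ++ [:: Some n, None & r]) (Cross (~~ true) (size l)) =
      Cap (size l).+2 by rewrite /finger_cap index_strand //= eqxx.
  rewrite wideE // index_strand //; split.
    have := acts_cap (l ++ [:: None; Some n]) r.
    by rewrite -!catA size_cat addn2 => /actP.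
  have hr : run [:: Cup 0; Cross true 1; Cap 2] [:: Some n; None] = Some [:: None; Some n] by [].
  have := eqv_frame l r hr (@chain_eqv _ _
    [:: [:: Cup 1; Cross false 0; Cap 2]; [:: Cup 1; Cap 2; Cross false 0];
        [:: Cross false 0]] _).
  rewrite /offset /= /offset_event /= !addn0 addn1 addn2; apply.
  by case: (n).
Qed.

Lemma forkP (n : strand) (s : slice) : Some n \in s ->
  clean s (fork (index (Some n) s)) /\
  crossings s (fork (index (Some n) s)) = [:: (n, true)].
Proof.
case/split_strand=> l [r [-> hl]]; rewrite index_strand //.
have h1 := clean_cup l (Some n :: r); have [c1 x1] := clean_actsE h1.
have h2 := clean_right true n (rcons l None) r; have [c2 x2] := clean_actsE h2.
rewrite cat_rcons size_rcons in c2 x2.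
rewrite /fork (clean_cons _ (clean_acts_act h1)) (crossings_cons _ (clean_acts_act h1)).
by rewrite clean1 crossings1 c1 x1 c2 x2.
Qed.

Definition sorted_crossings (C : seq (strand * bool)) : Prop :=
  forall n C1 C2, C = C1 ++ (n, true) :: C2 -> (n, false) \notin C1.

(** Induction on the last event. An overcrossing of [n] is turned into a finger whose tip goes down
    through [U] and joins [O]. Nothing in [U] crosses [n]: such a crossing would be an
    undercrossing, hence by the inclusion of crossings one of [D], below an overcrossing of [n]. *)
Lemma sort_front_back (D : diagram) (s t : slice) :
  filter isSome s = empty_slice -> run D s = Some t -> clean s D ->
  sorted_crossings (crossings s D) ->
  exists O U m, [/\ eqv s D (O ++ U), run O s = Some m,
    clean s O && all snd (crossings s O),
    clean m U && all (fun c => ~~ c.2) (crossings m U)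
    & {subset crossings m U <= crossings s D}].
Proof.
move=> es; elim/last_ind: D t => [|D e IH] t.
  by case=> _ _ _; exists [::], [::], s.
rewrite -cats1 => /run_catP[u hD]; rewrite run1 => he.
rewrite (clean_cat _ hD) (crossings_cat _ hD) clean1 crossings1.
case/andP=> cD ce so.
have soD : sorted_crossings (crossings s D).
  by move=> n C1 C2 eC; apply: (so n C1 (C2 ++ seq_of_opt (crossing_of u e))); rewrite eC -catA.
have [O [U [m [hOU hO cO cU sU]]]] := IH u hD cD soD.
have hU : run U m = Some u by move: hD; rewrite (eqv_run hOU) run_cat hO.
case/andP: cU => cU oU.
have hc := clean_actsP he ce; have [_ xe] := clean_actsE hc.
case E : (crossing_of u e) so hc xe => [[n o]|] so hc xe; last first.
  exists O, (U ++ [:: e]), m; split=> //.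
  - by rewrite catA; apply: eqv_catr.
  - by rewrite (clean_cat _ hU) (crossings_cat _ hU) clean1 crossings1 E cU ce /= cats0.
  - by rewrite (crossings_cat _ hU) crossings1 E cats0 => c /sU; rewrite mem_cat => ->.
case: o E so hc xe => E so hc xe; last first.
  exists O, (U ++ [:: e]), m; split=> //.
  - by rewrite catA; apply: eqv_catr.
  - by rewrite (clean_cat _ hU) (crossings_cat _ hU) clean1 crossings1 E cU ce /= all_cat oU.
  - rewrite (crossings_cat _ hU) crossings1 E => c; rewrite !mem_cat => /orP[/sU->|->] //.
    by rewrite orbT.
have av : avoids n (crossings m U).
  apply/allP=> -[n' o] hn /=; apply/eqP=> en; subst n'.
  have /allP/(_ _ hn)/= := oU; case: o hn => // hn _.
  by have /negP := so n _ [::] erefl; apply; apply: sU.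
have em : filter isSome m = empty_slice by rewrite -(run_strands hO).
have eu : filter isSome u = empty_slice by rewrite -(run_strands hU).
have hm := strand_in n em.
have [rw cw xw hw] := widenP hU cU hm av.
have [hcap ecap] := finger_capP eu hc.
have [cf xf] := forkP hm; have rf := run_fork hm.
exists (O ++ fork (index (Some n) m)), (widen n m U ++ [:: finger_cap n u e]), (wide n m).
split.
- apply: eqv_trans (eqv_catr [:: e] hOU) _; rewrite -!catA; apply: eqv_catl hO _.
  apply: eqv_trans (eqv_catl hU (eqv_sym ecap)) _; rewrite !catA.
  exact: eqv_catr.
- exact: run_catS hO rf.
- by rewrite (clean_cat _ hO) (crossings_cat _ hO) cf xf all_cat andbT /= andbT.
- by rewrite (clean_cat _ rw) (crossings_cat _ rw) cw xw crossings1 cats0 oU.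
- rewrite (crossings_cat _ rw) crossings1 xw cats0 => c /sU.
  by rewrite mem_cat => ->.
Qed.

Lemma good_sorted (D : diagram) :
  run D empty_slice = Some empty_slice -> clean empty_slice D ->
  sorted_crossings (crossings empty_slice D) -> good D.
Proof.
move=> hD cD so.
have es : filter isSome empty_slice = empty_slice by [].
have [O [U [m [h hO /andP[cO oO] /andP[cU oU] _]]]] := sort_front_back es hD cD so.
apply: (good_eqv h); apply: (good_front_back hO cO oO _ cU oU).
by move: hD; rewrite (eqv_run h) run_cat hO.
Qed.

(** * Heights *)

Lemma slice_at_size (L R : diagram) (s : slice) :
  run L empty_slice = Some s -> slice_at (L ++ R) (size L) = s.
Proof. by move=> hL; rewrite /slice_at take_size_cat // hL. Qed.

Lemma event_at_size (L R : diagram) (e : event) : event_at (L ++ e :: R) (size L) = e.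
Proof. by rewrite /event_at nth_cat ltnn subnn. Qed.

Lemma strand_crossing_size (L R : diagram) (e : event) (s : slice) :
  run L empty_slice = Some s -> strand_crossing (L ++ e :: R) (size L) = crossing_of s e.
Proof. by move=> hL; rewrite /strand_crossing event_at_size (slice_at_size _ hL). Qed.

Lemma crossings_iota (L M R : diagram) (s t : slice) :
  run L empty_slice = Some s -> run M s = Some t ->
  crossings s M = pmap (strand_crossing (L ++ M ++ R)) (iota (size L) (size M)).
Proof.
elim: M L s => // e M IH L s hL /run_consP[u hu hM].
rewrite (crossings_cons _ hu) /= (strand_crossing_size _ _ hL).
have hLe : run (rcons L e) empty_slice = Some u.
  by rewrite -cats1; apply: run_catS hL _.
have := IH (rcons L e) u hLe hM; rewrite cat_rcons size_rcons => ->.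
by case: crossing_of.
Qed.

Lemma clean_iota (L M R : diagram) (s t : slice) :
  run L empty_slice = Some s -> run M s = Some t ->
  clean s M = all (fun k => ~~ self_crossing (slice_at (L ++ M ++ R) k)
                                 (event_at (L ++ M ++ R) k))
                  (iota (size L) (size M)).
Proof.
elim: M L s => // e M IH L s hL /run_consP[u hu hM].
rewrite (clean_cons _ hu) /= event_at_size (slice_at_size _ hL).
have hLe : run (rcons L e) empty_slice = Some u.
  by rewrite -cats1; apply: run_catS hL _.
by have := IH (rcons L e) u hLe hM; rewrite cat_rcons size_rcons => ->.
Qed.

Lemma skein_termP (D : diagram) :
  skein_term D <-> run D empty_slice = Some empty_slice /\ clean empty_slice D.
Proof.
rewrite /skein_term /is_skein_diagram; split.
  case/andP=> /eqP hD; rewrite /crossingless => h; split=> //.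
  by rewrite (clean_iota [::] (L := [::]) erefl hD) cats0.
case=> hD; rewrite hD eqxx (clean_iota [::] (L := [::]) erefl hD) cats0.
by [].
Qed.

Lemma delete_minima_self (p : seq nat) : delete_minima p p = [::].
Proof. by elim: p => //= x p IH; rewrite eqxx. Qed.

(** Deletion stops at the first element of [q] in the merged list, and every remaining element of
    [p] is above that one. *)
Lemma delete_minima_merge (p q : seq nat) :
  sorted ltn p -> sorted ltn q -> {in p, forall k, k \notin q} ->
  delete_minima p (merge leq p q) = [seq c <- p | has (fun a => a < c) q].
Proof.
elim: p q => [|x p IH] [|y q] // hp hq hpq.
  have -> : [seq c <- x :: p | has (fun a => a < c) [::]] = [::].
    by elim: (x :: p).
  exact: delete_minima_self.
have sp := path_sorted hp.
have /allP lt_p : all (ltn x) p by apply: order_path_min hp; apply: ltn_trans.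
have /allP lt_q : all (ltn y) q by apply: order_path_min hq; apply: ltn_trans.
have ne : x != y.
  by have := hpq x (mem_head _ _); rewrite inE negb_or => /andP[].
case: (ltngtP x y) ne => // [lt_xy|lt_yx] _.
  have -> : merge leq (x :: p) (y :: q) = x :: merge leq p (y :: q) by rewrite /= ltnW.
  have hx : has (fun a => a < x) (y :: q) = false.
    by apply/hasP=> -[z]; rewrite inE => /orP[/eqP->|/lt_q/=]; lia.
  rewrite [LHS]/= eqxx IH // => [|k hk]; last by apply: hpq; rewrite inE hk orbT.
  by rewrite [filter _ (_ :: _)]/= -/(has _ (y :: q)) hx.
have -> : merge leq (x :: p) (y :: q) = y :: merge leq (x :: p) q by rewrite /= leqNgt lt_yx.
rewrite [LHS]/= (_ : y == x = false); last by lia.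
apply/esym/all_filterP/allP=> k; rewrite inE => /orP[/eqP->|/lt_p/= lt_k].
  by rewrite /= lt_yx.
by rewrite /= (ltn_trans lt_yx lt_k).
Qed.

(** * Inversions and the induction decision *)

Fixpoint inversions (w : seq bool) : nat :=
  if w is b :: w' then (if b then 0 else count id w') + inversions w' else 0.

Definition overs (n : strand) (C : seq (strand * bool)) : seq bool :=
  [seq c.2 | c <- C & c.1 == n].

Lemma inversions_swap (u v : seq bool) :
  inversions (u ++ [:: false, true & v]) = (inversions (u ++ [:: true, false & v])).+1.
Proof. by elim: u => [|[] u IH] //=; rewrite ?IH ?count_cat /=; lia. Qed.

Lemma overs_cat n C1 C2 : overs n (C1 ++ C2) = overs n C1 ++ overs n C2.
Proof. by rewrite /overs filter_cat map_cat. Qed.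

Lemma overs_avoids n C : avoids n C -> overs n C = [::].
Proof. by elim: C => //= c C IH /andP[/negPf h /IH]; rewrite /overs /= h. Qed.

Lemma inversions_gt0P n C : 0 < inversions (overs n C) <->
  exists C1 C2 C3, C = C1 ++ (n, false) :: C2 ++ (n, true) :: C3.
Proof.
split.
  elim: C => // -[n' o] C IH; rewrite /overs /=; case: eqVneq => [->|_] /=; last first.
    by move=> /IH[C1 [C2 [C3 ->]]]; exists ((n', o) :: C1), C2, C3.
  case: o => /=; first by move=> /IH[C1 [C2 [C3 ->]]]; exists ((n, true) :: C1), C2, C3.
  rewrite addn_gt0 => /orP[|/IH[C1 [C2 [C3 ->]]]]; last by exists ((n, false) :: C1), C2, C3.
  rewrite -has_count => /hasP[_ /mapP[[n'' o] hc ->]] /= ho.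
  move: hc; rewrite mem_filter /= => /andP[/eqP -> hc]; rewrite ho in hc.
  by case/splitPr: hc => C2 C3; exists [::], C2, C3.
move=> [C1 [C2 [C3 ->]]]; rewrite overs_cat.
have -> : overs n ((n, false) :: C2 ++ (n, true) :: C3) =
   false :: overs n C2 ++ true :: overs n C3.
  by rewrite {1}/overs /= eqxx /= -/(overs n _) overs_cat {2}/overs /= eqxx.
elim: (overs n C1) => [|b u IH] /=; last by rewrite addn_gt0 IH orbT.
by rewrite count_cat /=; lia.
Qed.

Lemma sorted_heights (D : diagram) (x : option (strand * bool)) :
  sorted ltn [seq k <- iota 0 (size D) | strand_crossing D k == x].
Proof. by apply: sorted_filter (iota_ltn_sorted _ _) => ? ? ?; apply: ltn_trans. Qed.

Lemma delete_minimaE (D : diagram) (n : strand) :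
  delete_minima (P D n) (B D n) = [seq c <- P D n | has (fun a => a < c) (N D n)].
Proof.
apply: delete_minima_merge; try exact: sorted_heights.
by move=> k; rewrite !mem_filter => /andP[/eqP-> _]; apply/negP=> /andP[/eqP[]].
Qed.

Lemma mem_P (D : diagram) n k :
  (k \in P D n) = (strand_crossing D k == Some (n, true)) && (k < size D).
Proof. by rewrite mem_filter mem_iota. Qed.

Lemma mem_N (D : diagram) n k :
  (k \in N D n) = (strand_crossing D k == Some (n, false)) && (k < size D).
Proof. by rewrite mem_filter mem_iota. Qed.

Lemma pmap_split (T : eqType) (T' : Type) (f : T -> option T') (s : seq T) C1 x C2 :
  pmap f s = C1 ++ x :: C2 ->
  exists s1 k s2, [/\ s = s1 ++ k :: s2, f k = Some x & pmap f s2 = C2].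
Proof.
elim: s C1 => [|y s IH] C1 /=; first by case: C1.
case fy: (f y) => [z|] /=; last first.
  by move=> /IH[s1 [k [s2 [-> ? <-]]]]; exists (y :: s1), k, s2.
case: C1 => [|z' C1] [ez h]; first by exists [::], y, s; rewrite fy ez.
by case: (IH _ h) => s1 [k [s2 [-> ? <-]]]; exists (y :: s1), k, s2.
Qed.

Lemma induction_decision_none (D : diagram) (n : strand) :
  run D empty_slice = Some empty_slice -> induction_decision D n = None ->
  inversions (overs n (crossings empty_slice D)) = 0.
Proof.
move=> hD hn; apply/eqP; rewrite -leqn0 leqNgt; apply/negP.
case/inversions_gt0P=> C1 [C2 [C3]].
have := crossings_iota [::] (L := [::]) erefl hD; rewrite cats0 => -> /=.
move=> e; case: (pmap_split e) => s1 [a [s2' [e1 fa e']]].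
case: (pmap_split e') => s2 [c [s3 [e2 fc _]]].
rewrite {}e2 in e1.
have ha : a \in iota 0 (size D) by rewrite e1 mem_cat mem_head orbT.
have hc : c \in iota 0 (size D) by rewrite e1 !(mem_cat, inE) eqxx !orbT.
have lt_ac : a < c.
  have := iota_ltn_sorted 0 (size D); rewrite e1 (sorted_pairwise ltn_trans) pairwise_cat /=.
  by case/and3P=> _ _ /andP[/allP h _]; apply: h; rewrite mem_cat mem_head orbT.
move: hn; rewrite /induction_decision delete_minimaE.
have : c \in [seq c <- P D n | has (fun a => a < c) (N D n)].
  rewrite mem_filter mem_filter fc eqxx hc /= andbT.
  by apply/hasP; exists a => //; rewrite mem_filter fa eqxx.
by case: filter.
Qed.

(** An overcrossing of [n] between [a] and [c] would be a smaller choice for [c], and an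
    undercrossing a larger choice for [a]. *)
Lemma induction_decision_some (D : diagram) (n : strand) (a c : nat) :
  run D empty_slice = Some empty_slice -> induction_decision D n = Some (a, c) ->
  [/\ a < c < size D, strand_crossing D a = Some (n, false),
      strand_crossing D c = Some (n, true)
    & forall k o, a < k < c -> strand_crossing D k <> Some (n, o)].
Proof.
move=> hD; rewrite /induction_decision delete_minimaE.
case E : [seq _ <- _ | _] => [|c' Q] // [ea ec]; subst c'.
have sQ : sorted ltn (c :: Q).
  by rewrite -E; apply: sorted_filter (sorted_heights _ _) => ? ? ?; apply: ltn_trans.
have : c \in c :: Q by rewrite mem_head.
rewrite -E mem_filter mem_P => /and3P[/hasP[a0 ha0 lt_a0] /eqP xc lt_c].
set Nc := [seq x <- N D n | x < c] in ea.
have sN : sorted ltn Nc.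
  by apply: sorted_filter (sorted_heights _ _) => ? ? ?; apply: ltn_trans.
have a0N : a0 \in Nc by rewrite mem_filter lt_a0.
(* [Nc] contains [a0], so the default value of [last 0] is not returned. *)
have aN : a \in Nc.
  by rewrite -ea; case: (Nc) a0N => // x s _ /=; apply: mem_last.
have max_a k : k \in Nc -> k <= a.
  rewrite -ea; case/lastP: (Nc) sN => // s x; rewrite last_rcons mem_rcons inE.
  rewrite (sorted_pairwise ltn_trans) pairwise_rcons => /andP[/allP h _].
  by case/orP=> [/eqP-> //|/h/ltnW].
move: (aN); rewrite mem_filter mem_N => /and3P[lt_ac /eqP xa _].
split=> //; first by rewrite lt_ac.
move=> k [] /andP[lt_ak lt_kc] xk.
  have : k \in c :: Q.
    rewrite -E mem_filter mem_P xk eqxx (ltn_trans lt_kc lt_c) !andbT.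
    by apply/hasP; exists a => //; move: aN; rewrite mem_filter => /andP[].
  rewrite inE => /orP[/eqP ek|hk]; first by rewrite ek ltnn in lt_kc.
  have /allP/(_ _ hk)/= := order_path_min ltn_trans sQ.
  by rewrite ltnNge ltnW.
have /max_a : k \in Nc by rewrite mem_filter lt_kc mem_N xk eqxx (ltn_trans lt_kc lt_c).
by rewrite leqNgt lt_ak.
Qed.

(** * Switching two crossings *)

(** Coefficients are forgotten: which terms can occur is all that matters. *)
Definition smoothed (s : slice) (D E : diagram) : Prop :=
  E \in [seq p.2 | p <- smoothings s D].

Lemma smoothed_clean1 (s t : slice) (e : event) (D E : diagram) :
  act e s = Some t -> ~~ self_crossing s e -> smoothed s (e :: D) E ->
  exists2 E', E = e :: E' & smoothed t D E'.
Proof.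
rewrite /smoothed /= => -> /negPf-> /=; rewrite -map_comp => /mapP[p hp ->].
by exists p.2 => //; apply: map_f.
Qed.

Lemma smoothed_clean_cat (s t : slice) (D1 D E : diagram) :
  run D1 s = Some t -> clean s D1 -> smoothed s (D1 ++ D) E ->
  exists2 E', E = D1 ++ E' & smoothed t D E'.
Proof.
elim: D1 s E => [|e D1 IH] s E; first by case=> -> _ h; exists E.
move=> /run_consP[u hu h1]; rewrite (clean_cons _ hu) => /andP[ce c1].
move=> /(smoothed_clean1 hu ce)[E' -> /(IH _ _ h1 c1)[E'' -> h]].
by exists E''.
Qed.

Lemma smoothed_clean (s t : slice) (D E : diagram) :
  run D s = Some t -> clean s D -> smoothed s D E -> E = D.
Proof.
move=> h c; rewrite -{1}[D]cats0 => /(smoothed_clean_cat h c)[E' ->].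
by rewrite /smoothed inE => /eqP->; rewrite cats0.
Qed.

Definition smoothing_at (j : nat) (v : diagram) : Prop :=
  v = [::] \/ v = [:: Cap j; Cup j].

Lemma smoothing_atP (l r : slice) (v : diagram) :
  smoothing_at (size l) v ->
  let s := l ++ [:: None, None & r] in
  [/\ run v s = Some s, clean s v & crossings s v = [::]].
Proof.
case=> -> s //; have h1 := clean_cap l r; have h2 := clean_cup l r.
have [c1 x1] := clean_actsE h1; have [c2 x2] := clean_actsE h2.
rewrite (clean_cons _ (clean_acts_act h1)) (crossings_cons _ (clean_acts_act h1)).
rewrite clean1 crossings1 x1 ?c1 x2 ?c2; split=> //.
exact: run2 (clean_acts_act h1) (clean_acts_act h2).
Qed.

(** Covers the R1 and R2 forms of [switch] at once: [w] is either a smoothing already or a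
    self-crossing still to be resolved, and a smoothing remains in both cases. *)
Lemma smoothed_self (l r : slice) (w D E : diagram) :
  smoothing_at (size l) w \/ (exists b, w = [:: Cross b (size l)]) ->
  smoothed (l ++ [:: None, None & r]) (w ++ D) E ->
  exists v E', [/\ smoothing_at (size l) v, E = v ++ E'
                 & smoothed (l ++ [:: None, None & r]) D E'].
Proof.
case=> [hw h|[b ->]].
  have [rw cw _] := smoothing_atP r hw.
  by have [E' -> h'] := smoothed_clean_cat rw cw h; exists w, E'.
set s := l ++ _; rewrite /smoothed /=.
have -> : take 2 (drop (size l) s) == [:: None; None].
  by rewrite /s drop_size_cat //= take0.
have -> : odflt s (act (Cross b (size l)) s) = s.
  have hs : act (Cross b (size l)) s = Some s by apply/actP/acts_cross.
  by rewrite hs.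
case: b => /=; rewrite map_cat -!map_comp mem_cat => /orP[] /mapP[p hp ->] /=.
- by exists [::], p.2; split; [left| |apply: map_f].
- by exists [:: Cap (size l); Cup (size l)], p.2; split; [right| |apply: map_f].
- by exists [:: Cap (size l); Cup (size l)], p.2; split; [right| |apply: map_f].
- by exists [::], p.2; split; [left| |apply: map_f].
Qed.

Lemma widen_iota (n : strand) (L M R : diagram) (s t : slice) :
  run L empty_slice = Some s -> run M s = Some t ->
  widen n s M =
    [seq widen_event n (slice_at (L ++ M ++ R) k) (event_at (L ++ M ++ R) k)
       | k <- iota (size L) (size M)].
Proof.
elim: M L s => // e M IH L s hL /run_consP[u hu hM].
rewrite /= event_at_size (slice_at_size _ hL) hu /=.
have hLe : run (rcons L e) empty_slice = Some u.
  by rewrite -cats1; apply: run_catS hL _.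
by have := IH (rcons L e) u hLe hM; rewrite cat_rcons size_rcons => ->.
Qed.

(** [under] is the local definition of that name in [switch]. *)
Lemma smoothed_under (n : strand) (e : event) (s t : slice) (arc : option bool) :
  filter isSome s = empty_slice -> clean_acts e s t (Some (n, false)) ->
  let p := index (Some n) s in
  let right := pos e != p in
  let cross j := [:: Cross (~~ right) j] in
  let before j := if arc == Some (~~ right) then [:: Cap j; Cup j] else cross j in
  let after j := if arc == Some right then [::] else cross j in
  let under := if right then before p.-1 ++ cross p ++ after p.+1
               else before p.+2 ++ cross p.+1 ++ after p in
  forall D E, smoothed (wide n s) (under ++ D) E ->
  exists U E', [/\ E = U ++ E', run U (wide n s) = Some (wide n t),
    clean (wide n s) U, crossings (wide n s) U = [:: (n, false)]
    & smoothed (wide n t) D E'].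
Proof.
move=> es; move Ec: (Some (n, false)) => c h.
(* [x] is the undercrossing of the strand; [w1] and [w2] are the meetings with the two legs of the
   finger, before and after it. *)
have main l1 r1 l2 r2 s1 s2 x w1 w2 D E :
    clean_acts x s1 s2 (Some (n, false)) ->
    s1 = l1 ++ [:: None, None & r1] -> s2 = l2 ++ [:: None, None & r2] ->
    smoothing_at (size l1) w1 \/ (exists b, w1 = [:: Cross b (size l1)]) ->
    smoothing_at (size l2) w2 \/ (exists b, w2 = [:: Cross b (size l2)]) ->
    smoothed s1 ((w1 ++ [:: x] ++ w2) ++ D) E ->
    exists U E', [/\ E = U ++ E', run U s1 = Some s2,
      clean s1 U, crossings s1 U = [:: (n, false)] & smoothed s2 D E'].
  move=> hx e1 e2 h1 h2; rewrite -!catA e1.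
  case/(smoothed_self h1)=> v1 [E1 [hv1 -> hE1]].
  have [cx xx] := clean_actsE hx; have ax := clean_acts_act hx.
  rewrite -e1 in hE1; case: (smoothed_clean1 ax cx hE1) => E2 ->.
  rewrite e2 => /(smoothed_self h2)[v2 [E3 [hv2 -> hE3]]].
  have [rv1 cv1 xv1] := smoothing_atP r1 hv1; have [rv2 cv2 xv2] := smoothing_atP r2 hv2.
  rewrite -{}e1 -{}e2 in rv1 cv1 xv1 rv2 cv2 xv2 hE3 *.
  exists (v1 ++ [:: x] ++ v2), E3; rewrite -!catA.
  have rx : run [:: x] s1 = Some s2 by [].
  rewrite (clean_cat _ rv1) (crossings_cat _ rv1) (clean_cat _ rx) (crossings_cat _ rx).
  rewrite clean1 crossings1 cx xx cv1 cv2 xv1 xv2; split=> //.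
  exact: run_catS rv1 (run_catS rx rv2).
have hb b0 (j k : nat) (w : diagram) (q : bool) : j = k -> w = [::] \/ w = [:: Cap j; Cup j] ->
    smoothing_at k (if q then w else [:: Cross b0 j]) \/
    (exists b, (if q then w else [:: Cross b0 j]) = [:: Cross b k]).
  by move=> -> hw; case: q; [left|right; exists b0].
case: h Ec es => [//|//|o n' l r [<- <-]|o n' l r [<- <-]].
- move=> es; have hl : Some n \notin rcons l None.
    by apply: (@strand_unique n _ r); rewrite cat_rcons.
  have hl' : Some n \notin l by move: hl; rewrite mem_rcons inE.
  have -> : index (Some n) (l ++ [:: None, Some n & r]) = (size l).+1.
    by rewrite -cat_rcons index_strand // size_rcons.
  rewrite /= (_ : size l != (size l).+1); last by rewrite neq_ltn ltnSn.
  have -> : wide n (l ++ [:: None, Some n & r]) = l ++ [:: None, None, Some n, None & r].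
    by rewrite -cat_rcons wideE // cat_rcons.
  rewrite wideE // => D E.
  apply: (main l [:: Some n, None & r] (l ++ [:: None; Some n]) r) => //=.
  + by have := clean_right false n (rcons l None) (None :: r); rewrite !cat_rcons size_rcons.
  + by rewrite -catA.
  + by apply: hb => //; right.
  + by apply: hb; [rewrite size_cat addn2|left].
- move=> es; have hl := strand_unique es.
  have -> : index (Some n) (l ++ [:: Some n, None & r]) = size l by rewrite index_strand.
  rewrite /= eqxx /= wideE //.
  have -> : wide n (l ++ [:: None, Some n & r]) = l ++ [:: None, None, Some n, None & r].
    by rewrite -cat_rcons wideE ?mem_rcons ?inE // cat_rcons.
  move=> D E.
  apply: (main (l ++ [:: None; Some n]) r l [:: Some n, None & r]) => //=.
  + by have := clean_left false n (rcons l None) (None :: r); rewrite !cat_rcons size_rcons.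
  + by rewrite -catA.
  + by apply: hb; [rewrite size_cat addn2|right].
  + by apply: hb => //; left.
Qed.

Lemma split_diagram (D : diagram) (a c : nat) : a < c < size D ->
  exists L e M f R, [/\ D = L ++ e :: M ++ f :: R, size L = a & (size L + size M).+1 = c].
Proof.
case/andP=> lt_ac lt_c.
exists (take a D), (nth (Cup 0) D a), (take (c - a.+1) (drop a.+1 D)),
  (nth (Cup 0) D c), (drop c.+1 D).
have sz : size (take a D) = a by rewrite size_takel // ltnW // (ltn_trans lt_ac).
have szM : size (take (c - a.+1) (drop a.+1 D)) = c - a.+1.
  by rewrite size_takel // size_drop; lia.
rewrite sz szM; split=> //; last by lia.
have -> : drop c.+1 D = drop (c - a.+1).+1 (drop a.+1 D).
  by rewrite drop_drop; congr drop; lia.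
have -> : nth (Cup 0) D c = nth (Cup 0) (drop a.+1 D) (c - a.+1).
  by rewrite nth_drop; congr nth; lia.
rewrite -drop_nth ?size_drop; last by lia.
rewrite cat_take_drop -drop_nth ?cat_take_drop //.
exact: ltn_trans lt_c.
Qed.

(** The finger crosses the strand once, just below the undercrossing, and its cap at the old height
    of [c] crosses nothing. Smoothings of self-crossings do not touch the strands, so neither [arc]
    nor the choice of smoothing affects the sequence of crossings. *)
Lemma switch_smoothed (T E : diagram) (n : strand) (a c : nat) (arc : option bool) :
  skein_term T -> induction_decision T n = Some (a, c) ->
  smoothed empty_slice (switch T n a c arc) E ->
  skein_term E /\
  exists CL CM CR, [/\ avoids n CM,
    crossings empty_slice T = CL ++ (n, false) :: CM ++ (n, true) :: CR
    & crossings empty_slice E = CL ++ (n, true) :: (n, false) :: CM ++ CR].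
Proof.
case/skein_termP=> hT cT hd hS; have [lt_ac xa xc av] := induction_decision_some hT hd.
case: (split_diagram lt_ac) => L [ea [M [ec [R [eT sL sM]]]]].
move: hT; rewrite eT => /run_catP[s1 h1 /run_consP[s2 h2 /run_catP[s3 h3 /run_consP[s4 h4 h5]]]].
have es1 : filter isSome s1 = empty_slice by rewrite -(run_strands h1).
have es2 : filter isSome s2 = empty_slice by rewrite -(act_strands h2).
have es3 : filter isSome s3 = empty_slice by rewrite -(run_strands h3).
have h12 : run (rcons L ea) empty_slice = Some s2 by rewrite -cats1; apply: run_catS h1 _.
have h13 : run (L ++ ea :: M) empty_slice = Some s3.
  by rewrite -cat_rcons; apply: run_catS h12 h3.
have eT2 : T = rcons L ea ++ M ++ ec :: R by rewrite cat_rcons.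
have eT3 : T = (L ++ ea :: M) ++ ec :: R by rewrite -catA.
have ec' : c = size (L ++ ea :: M) by rewrite size_cat /= addnS.
have xea : crossing_of s1 ea = Some (n, false).
  by rewrite -xa -(strand_crossing_size (M ++ ec :: R) ea h1) eT sL.
have xec : crossing_of s3 ec = Some (n, true).
  by rewrite -xc ec' -(strand_crossing_size R ec h13) eT3.
have avM : avoids n (crossings s2 M).
  rewrite (crossings_iota (ec :: R) h12 h3) -eT2 size_rcons sL.
  apply/allP=> -[n' o]; rewrite mem_pmap => /mapP[k].
  rewrite mem_iota => hk /esym xk /=; apply/eqP=> en; subst n'.
  by apply: (av k o) xk; lia.
move: cT; rewrite eT (clean_cat _ h1) (clean_cons _ h2) (clean_cat _ h3) (clean_cons _ h4).
case/and5P=> c1 c2 c3 c4 c5.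
have hea := clean_actsP h2 c2; rewrite xea in hea.
have hec := clean_actsP h4 c4; rewrite xec in hec.
have i1 := strand_in n es1; have i2 := strand_in n es2.
have rf := run_fork i1; have [cf xf] := forkP i1.
have [rw cw xw _] := widenP h3 c3 i2 avM.
have [rcap _] := finger_capP es3 hec.
have sa1 : slice_at T a = s1 by rewrite eT -sL (slice_at_size _ h1).
have sc3 : slice_at T c = s3 by rewrite eT3 ec' (slice_at_size _ h13).
have ea1 : event_at T a = ea by rewrite eT -sL event_at_size.
have ec3 : event_at T c = ec by rewrite eT3 ec' event_at_size.
have hw : [seq widen_event n (slice_at T k) (event_at T k) | k <- iota a.+1 (c - a.+1)] =
    widen n s2 M.
  by rewrite (widen_iota n (ec :: R) h12 h3) -eT2 size_rcons sL; congr map; congr iota; lia.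
have tL : take a T = L by rewrite eT take_size_cat.
have dR : drop c.+1 T = R by rewrite eT3 ec' drop_size_cat1.
move: hS; rewrite /switch sa1 sc3 ea1 ec3 tL dR.
(* The local [make_room] of [switch] is [widen_event], read by heights. *)
have -> : [seq (let e := event_at T k in
    if pos e <= index (Some n) (slice_at T k) then e else at_pos e (pos e).+2)
    | k <- iota a.+1 (c - a.+1)] = widen n s2 M by exact: hw.
rewrite -/(fork _) -/(finger_cap n s3 ec).
case/(smoothed_clean_cat h1 c1)=> E1 ->.
case/(smoothed_clean_cat rf cf)=> E2 ->.
case/(smoothed_under es1 hea)=> U [E3 [-> rU cU xU]].
case/(smoothed_clean_cat rw cw)=> E4 ->.
have rcap1 : run [:: finger_cap n s3 ec] (wide n s3) = Some s4 by [].
case/(smoothed_clean_cat rcap1 isT)=> E5 -> /(smoothed_clean h5 c5) ->.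
split.
  apply/skein_termP; split.
    apply: run_catS h1 (run_catS rf (run_catS rU (run_catS rw (run_catS rcap1 h5)))).
  rewrite (clean_cat _ h1) (clean_cat _ rf) (clean_cat _ rU) (clean_cat _ rw) (clean_cat _ rcap1).
  by rewrite c1 cf cU cw.
exists (crossings empty_slice L), (crossings s2 M), (crossings s4 R); split=> //.
  rewrite (crossings_cat _ h1) (crossings_cons _ h2) (crossings_cat _ h3) (crossings_cons _ h4).
  by rewrite xea xec.
rewrite (crossings_cat _ h1) (crossings_cat _ rf) (crossings_cat _ rU)
  (crossings_cat _ rw) (crossings_cat _ rcap1).
by rewrite xf xU xw.
Qed.

(** * The strand sorting method *)

Definition unsorted (n : strand) (T : diagram) : nat :=
  inversions (overs n (crossings empty_slice T)).

Lemma overs_cons n n' o C :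
  overs n ((n', o) :: C) = if n' == n then o :: overs n C else overs n C.
Proof. by rewrite /overs /=; case: eqP. Qed.

Lemma unsorted_switch (T E : diagram) (n : strand) (a c : nat) (arc : option bool) :
  skein_term T -> induction_decision T n = Some (a, c) ->
  smoothed empty_slice (switch T n a c arc) E ->
  [/\ skein_term E, unsorted n T = (unsorted n E).+1
    & unsorted (~~ n) E = unsorted (~~ n) T].
Proof.
move=> hT hd /(switch_smoothed hT hd)[hE [CL [CM [CR [av xT xE]]]]]; split=> //.
  rewrite /unsorted xT xE !(overs_cat, overs_cons) !eqxx.
  by rewrite (overs_avoids av) inversions_swap.
rewrite /unsorted xT xE !(overs_cat, overs_cons).
by have -> : n == ~~ n = false by case: (n).
Qed.

(** If a step could produce no terms, the next term of the list would inherit the current strand and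
    skip strand 1. *)
Lemma smoothings_neq_nil (s : slice) (D : diagram) : smoothings s D != [::].
Proof.
elim: D s => //= e D IH s; case: ifP => _; last first.
  by case: smoothings (IH (odflt s (act e s))).
case: (match e with Cross true _ => _ | _ => _ end) => A B.
by case: smoothings (IH (odflt s (act e s))).
Qed.

Lemma good_term (T : diagram) :
  skein_term T -> (forall n, unsorted n T = 0) -> good T.
Proof.
move=> /skein_termP[hT cT] h; apply: good_sorted => // n C1 C2 eC; apply/negP => hC1.
suff : 0 < unsorted n T by rewrite h.
apply/inversions_gt0P; rewrite eC; case/splitPr: hC1 => B1 B2.
by exists B1, B2, C2; rewrite -catA.
Qed.

(** * Runs of the sorting method *)

Definition reaches (R : realType) (arr : diagram -> seq (seq dart))
    (st st' : sort_state R) : Prop :=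
  exists k, iter k (sort_step arr) st = st'.

Lemma reaches_trans (R : realType) arr (st2 st1 st3 : sort_state R) :
  reaches arr st1 st2 -> reaches arr st2 st3 -> reaches arr st1 st3.
Proof. by move=> [k1 <-] [k2 <-]; exists (k2 + k1); rewrite iterD. Qed.

Lemma reaches_step (R : realType) arr (st st' : sort_state R) :
  reaches arr (sort_step arr st) st' -> reaches arr st st'.
Proof. by apply: reaches_trans; exists 1. Qed.

Definition all_good (R : realType) (Z : lincomb R) : Prop :=
  forall p, p \in Z -> good p.2.

(** Quantifying over the output [dn] so far and the terms [rest] still waiting allows runs to be
    chained; every run ends with the strand reset to [strand1]. *)
Definition sorts (R : realType) (arr : diagram -> seq (seq dart))
    (n : strand) (l : lincomb R) : Prop :=
  forall dn rest, exists2 out, all_good out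
    & reaches arr (SortState dn n (l ++ rest)) (SortState (dn ++ out) strand1 rest).

Lemma sorts_cons (R : realType) arr n (p : ratfun R * diagram) (l : lincomb R) :
  sorts arr n [:: p] -> sorts arr strand1 l -> sorts arr n (p :: l).
Proof.
move=> hp hl dn rest; have [out1 g1 r1] := hp dn (l ++ rest).
have [out2 g2 r2] := hl (dn ++ out1) rest; exists (out1 ++ out2).
  by move=> q; rewrite mem_cat => /orP[/g1|/g2].
by rewrite catA; apply: reaches_trans r1 r2.
Qed.

Lemma sorts_list (R : realType) arr (l : lincomb R) :
  (forall p, p \in l -> sorts arr strand1 [:: p]) -> sorts arr strand1 l.
Proof.
elim: l => [|p l IH] h.
  by move=> dn rest; exists [::] => //; exists 0; rewrite cats0.
apply: sorts_cons; first by apply: h; rewrite mem_head.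
by apply: IH => q hq; apply: h; rewrite inE hq orbT.
Qed.

(** Induction on the number of inversions on both strands together, since switching on one strand
    keeps the inversions of the other. For the same reason strand 1 stays sorted while strand 2 is
    processed, as the second hypothesis records. *)
Lemma sorts_term (R : realType) arr (n : strand) (T : diagram) (r : ratfun R) :
  skein_term T -> (n = strand2 -> unsorted strand1 T = 0) ->
  sorts arr n [:: (r, T)].
Proof.
have [m] := ubnP (unsorted strand1 T + unsorted strand2 T).
elim: m n T r => // m IH n T r lt_m hT hn.
have step n' a c : (n' = strand2 -> unsorted strand1 T = 0) ->
    induction_decision T n' = Some (a, c) -> sorts arr n' [:: (r, T)].
  move=> hn' hd dn rest.
  set l : lincomb R := [seq ((r * p.1)%R, p.2)
    | p <- resolve R (switch T n' a c (consecutive T (arr T) a c))].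
  have hl p : p \in l -> [/\ skein_term p.2,
      unsorted strand1 p.2 + unsorted strand2 p.2 < m
      & n' = strand2 -> unsorted strand1 p.2 = 0].
    case: p => q E /mapP[_ /mapP[z hz ->] [_ ->]].
    have := unsorted_switch hT hd (map_f snd hz).
    move: (snd z : diagram) => {}E [hE e1 e2].
    split=> // [|en']; last by rewrite en' in e2 hn'; rewrite [LHS]e2 hn'.
    by rewrite /strand1 /strand2 in lt_m *; case: (n') e1 e2 => /= e1 e2; lia.
  have l_nil : l != [::].
    by rewrite /l -size_eq0 !size_map size_eq0 smoothings_neq_nil.
  have [out go ro] : exists2 out, all_good out &
      reaches arr (SortState dn n' (l ++ rest)) (SortState (dn ++ out) strand1 rest).
    (* The first new term continues on strand [n']; the others are started afresh on strand 1. *)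
    case: l l_nil hl => // -[q E] l _ hl.
    apply: sorts_cons.
      by have [hE lt_E hE'] := hl _ (mem_head _ _); apply: IH.
    apply: sorts_list => -[q' E'] hE'.
    have [? ? _] := hl (q', E') (mem_behead (s := _ :: l) hE').
    exact: IH.
  exists out => //; apply: reaches_step; rewrite /sort_step /= hd.
  exact: ro.
have step2 : unsorted strand1 T = 0 -> sorts arr strand2 [:: (r, T)].
  move=> h1; case hd : (induction_decision T strand2) => [[a c]|].
    exact: step hd.
  move=> dn rest; exists [:: (r, T)].
    move=> p; rewrite inE => /eqP-> /=; apply: good_term => // -[] //.
    by have /skein_termP[hT' _] := hT; apply: induction_decision_none.
  by exists 1; rewrite /= /sort_step /= hd cats1.
case: n hn => hn; first exact/step2/hn.
case hd : (induction_decision T strand1) => [[a c]|]; first exact: step hd.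
move=> dn rest; have /skein_termP[hT' _] := hT.
have [out go ro] := step2 (induction_decision_none hT' hd) dn rest.
exists out => //; apply: reaches_step; rewrite /sort_step /= hd.
exact: ro.
Qed.

Theorem theorem3p3 (R : realType)
    (D : diagram) (hD : is_skein_diagram D)
    (Z : lincomb R)
    (hZ : forall p, p \in Z -> laurent p.1 /\ skein_term p.2)
    (hDZ : forall T : diagram, coefficient Z T = coefficient (resolve R D) T)
    (arr : diagram -> seq (seq dart))
    (harr : forall T : diagram, skein_term T -> traversal T (arr T)) :
  exists (s : nat),
    let out := iter s (sort_step arr) (sort_start Z) in
    todo out = [::] /\
    forall p, p \in done out ->
      exists i j k u : nat, isotopic p.2 (parallel_copies i j k u).
Proof.
have [|out go [s hs]] := @sorts_list R arr Z _ [::] [::].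
  by move=> [r T] /hZ[_ hT]; apply: sorts_term.
rewrite cats0 in hs; exists s; rewrite /= /sort_start hs; split=> // p /go hp.
have [i [j [k [u h]]]] := good_parallel hp; exists i, j, k, u.
(* [isotopic] asks for a closed diagram: the output term has the same run as a concatenation of
   closed curves. *)
apply: isotopic_eqv h; case: hp => cs hcs h'.
by rewrite /is_skein_diagram (eqv_run h') run_flatten.
Qed.
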